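(* Let $m,n\ge 1$ be integers, let $\mu\subseteq\lambda$ be partitions, let $\ell$ be the length of the conjugate partition $\lambda'$, and suppose $\lambda'_i-\mu'_i>0$ for $i=1,\dots,\ell$. Let $r$ be an integer (a color). If the colored skew shape $(\lambda/\mu)^{(r)}$ satisfies the corner color condition, then $$ s_{\lambda/\mu}^{(r)}(\mathbf{x}_1,\dots,\mathbf{x}_m)=\Delta_{I(\mu,r),\,J(\lambda,r)}(\widetilde{M}'), $$ where $$ I(\mu,r)=\{\mu'_\ell-\ell+1+r,\ \mu'_{\ell-1}-\ell+2+r,\ \dots,\ \mu'_1+r\},\qquad J(\lambda,r)=\{\lambda'_\ell-\ell+1+r-m,\ \lambda'_{\ell-1}-\ell+2+r-m,\ \dots,\ \lambda'_1+r-m\}. $$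
   Context: Intervals: $[a,b]=\{k\in\mathbb{Z}: a\le k\le b\}$, $[k]=[1,k]$. The $x_i^j$ ($i\in[m]$, $j\in[n]$) are independent indeterminates over $\mathbb{C}$. For $i\in[m]$, $r\in\mathbb{Z}$, put $x_i^{(r)}=x_i^{j}$ where $j\in[n]$, $j\equiv r-i+1 \pmod n$. $\mathbf{x}_i=(x_i^1,\dots,x_i^n)$. Partitions are drawn in English notation; the cell $s=(a,b)$ (row $a$, column $b$) has content $c(s)=a-b$. $\lambda'$ is the conjugate of $\lambda$ (with $\mu'_i=0$ beyond its length). A semistandard Young tableau (SSYT) of skew shape $\lambda/\mu$ is a filling by positive integers weakly increasing along rows (left to right) and strictly increasing down columns. The loop skew Schur function is $$s^{(r)}_{\lambda/\mu}=s^{(r)}_{\lambda/\mu}(\mathbf{x}_1,\dots,\mathbf{x}_m)=\sum_T\prod_{s\in\lambda/\mu}x_{T(s)}^{(c(s)+r)},$$ summed over SSYT $T$ of shape $\lambda/\mu$ with entries in $[m]$ (equal to $1$ if $\lambda=\mu$). If $\mu=\emptyset$, write $s_\lambda^{(r)}$. The colored skew shape $\rho^{(r)}$ is $\rho$ with cell $s$ given the color $c(s)+r$ mod $n$. A NW corner of $\rho$ is a cell $(a,b)\in\rho$ with $(a-1,b),(a,b-1)\notin\rho$; a SE corner is a cell $(a,b)\in\rho$ with $(a+1,b),(a,b+1)\notin\rho$. $\rho^{(r)}$ satisfies the corner color condition if every NW corner has color $n$ and every SE corner has color $m$ (colors mod $n$). Shape invariants: for $1\le k\le p:=\min(m,n)$,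 $S_k=s^{(n)}_{((n-k+1)^{m-k+1})}$ (rectangle with $m-k+1$ rows of length $n-k+1$); $S_{p+1}=1$. Reduced $Q$-invariants: for $i\in[m]$, $j\in[n]$ with $i+j\le m$, let $0\le K\le n-1$ with $K\equiv i+j-m-1\pmod n$, and let $$\lambda_i^j=\big((n-j+K+1)^{m-n+K},\,(n-j)^{m-i-j}\big),\qquad \mu_i^j=\big((n-j+1)^{m-n+K-i}\big)$$ (exponents denote multiplicities). Then $\widetilde{Q}_i^{(j)}=\dfrac{s^{(n-j+1)}_{\lambda_i^j/\mu_i^j}}{S_{j+1}S_{n+1-K}}$. Also $\widetilde{Q}_0^{(j)}=1$ and $\widetilde{Q}_k^{(j)}=0$ for $k<0$. Matrix: define the $n\times n$ matrix $\widehat{M}'(t)_{ij}=M'_{ij}+\sum_{d>0}t^d\,\widetilde{Q}^{(i)}_{m+j-i-nd}$, where $M'_{ij}=(-1)^{n-i}S_i/S_{i+1}$ if $i\le m$ and $i+j=n+1$; $M'_{ij}=1$ if $i-j=m$; $M'_{ij}=0$ otherwise. $\widetilde{M}'$ is its unfolded version: the $\mathbb{Z}\times\mathbb{Z}$ matrix with $\widetilde{M}'_{a+n,b+n}=\widetilde{M}'_{a,b}$ for all $a,b$ and such that $\widetilde{M}'_{i+dn,j}$ is the coefficient of $t^d$ in $\widehat{M}'(t)_{ij}$ for all $i,j\in[n]$, $d\in\mathbb{Z}$. $\Delta_{I,J}(A)$ is the determinant of the submatrix of $A$ with rows $I$ and columns $J$ (in increasing order). *)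

(* Defs.v *)
From HB Require Import structures.
From mathcomp Require Import all_boot all_order all_algebra.
From mathcomp Require Import fraction reals complex mpoly.

Set Implicit Arguments.
Unset Strict Implicit.
Unset Printing Implicit Defensive.

Import Order.TTheory GRing.Theory Num.Theory.

Local Open Scope ring_scope.

(* Partitions are weakly decreasing lists of row lengths.  Rows, columns and   *)
(* parts are numbered from 1; [part la a] is 0 beyond the length of [la].      *)
Definition is_partition (la : seq nat) : bool :=
  sorted geq la && (0%N \notin la).

Definition part (la : seq nat) (a : nat) : nat := nth 0%N la a.-1.

Definition conj_part (la : seq nat) : seq nat :=
  [seq count (leq c) la | c <- iota 1 (part la 1)].

Definition part_sub (mu la : seq nat) : Prop :=
  forall a : nat, (part mu a <= part la a)%N.

(* Zero rows are harmless here, so lists with trailing zeros may be used as    *)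
(* shapes.                                                                     *)
Definition skew_cells (la mu : seq nat) : seq (nat * nat) :=
  [seq (a, b) | a <- iota 1 (size la),
                b <- iota (part mu a).+1 (part la a - part mu a)].

(* Contents are rows minus columns (the opposite of the usual sign).           *)
Definition content (s : nat * nat) : int := s.1%:Z - s.2%:Z.

Definition nw_corner (la mu : seq nat) (s : nat * nat) : bool :=
  [&& s \in skew_cells la mu, (s.1.-1, s.2) \notin skew_cells la mu
    & (s.1, s.2.-1) \notin skew_cells la mu].

Definition se_corner (la mu : seq nat) (s : nat * nat) : bool :=
  [&& s \in skew_cells la mu, (s.1.+1, s.2) \notin skew_cells la mu
    & (s.1, s.2.+1) \notin skew_cells la mu].

Definition corner_color_condition (m n : nat) (r : int) (la mu : seq nat) :
    Prop :=
  (forall s, nw_corner la mu s -> (content s + r = n%:Z %[mod n%:Z])%Z) /\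
  (forall s, se_corner la mu s -> (content s + r = m%:Z %[mod n%:Z])%Z).

(* The value [v : 'I_m] stands for the entry [v.+1] of [m].                    *)
Definition is_ssyt (m : nat) (la mu : seq nat)
    (T : {ffun seq_sub (skew_cells la mu) -> 'I_m}) : bool :=
  [forall s, forall t,
     (((val s).1 == (val t).1) && ((val s).2 < (val t).2)%N
        ==> (T s <= T t)%N) &&
     (((val s).2 == (val t).2) && ((val s).1 < (val t).1)%N
        ==> (T s < T t)%N)].

(* The determinant of the submatrix with row set [I] and column set [J], for   *)
(* duplicate-free lists [I] and [J] of the same size.                          *)
Definition minor (F : fieldType) (A : int -> int -> F) (I J : seq int) : F :=
  \det (\matrix_(a < size I, b < size I)
          A (nth 0 (sort <=%R I) a) (nth 0 (sort <=%R J) b)).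

(* The Z x Z matrix attached to an n x n matrix [A] of polynomials in t, whose *)
(* entries [A i j] are indexed by 1 <= i, j <= n: if a = i + d n and           *)
(* b = j + e n, the entry at (a, b) is the coefficient of t^(d - e) in A i j.  *)
Definition unfold_mx (F : fieldType) (n : nat) (A : nat -> nat -> {poly F})
    (a b : int) : F :=
  let i := `|((a - 1) %% n%:Z)%Z|.+1 in
  let j := `|((b - 1) %% n%:Z)%Z|.+1 in
  if ((a - 1) %/ n%:Z)%Z - ((b - 1) %/ n%:Z)%Z is Posz d then (A i j)`_d else 0.

Section LoopSchur.

(* [x i j] is x_(i+1)^(j+1).                                                   *)
Variables (F : fieldType) (m n : nat) (x : 'M[F]_(m, n)).

(* For 0 < n the sum has exactly one term.                                     *)
Definition loop_var (i : 'I_m) (r : int) : F :=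
  \sum_(j < n | (j.+1%:Z == r - i.+1%:Z + 1 %[mod n%:Z])%Z) x i j.

Definition loop_schur (r : int) (la mu : seq nat) : F :=
  \sum_(T : {ffun seq_sub (skew_cells la mu) -> 'I_m} | is_ssyt T)
    \prod_s loop_var (T s) (content (val s) + r).

(* Meaningful for 1 <= k <= minn m n + 1.                                      *)
Definition shape_inv (k : nat) : F :=
  if (k <= minn m n)%N
  then loop_schur n%:Z (nseq (m - k + 1) (n - k + 1)%N) [::]
  else 1.

(* Meaningful for i <= 0, or 1 <= j <= n and i + j <= m; in the latter case    *)
(* n <= m + K and i <= m + K - n, so no subtraction below is truncated.        *)
Definition Qred (i : int) (j : nat) : F :=
  match i with
  | Posz 0 => 1
  | Posz i =>
      let K := `|((i%:Z + j%:Z - m%:Z - 1) %% n%:Z)%Z|%N in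
      let la := nseq (m + K - n) (n - j + K + 1)%N
                  ++ nseq (m - i - j) (n - j)%N in
      let mu := nseq (m + K - n - i) (n - j + 1)%N in
      loop_schur (n%:Z - j%:Z + 1) la mu
        / (shape_inv (j + 1) * shape_inv (n + 1 - K))
  | Negz _ => 0
  end.

Definition Mprime (i j : nat) : F :=
  if (i <= m)%N && (i + j == n + 1)%N
  then (-1) ^+ (n - i) * (shape_inv i / shape_inv (i + 1))
  else if i == (j + m)%N then 1 else 0.

(* For 1 <= i, j <= n and m + n <= d the index m + j - i - n d is negative, so *)
(* the truncated sum contains all the nonzero terms.                           *)
Definition Mhat (i j : nat) : {poly F} :=
  (Mprime i j)%:P
  + \sum_(1 <= d < m + n)
      Qred (m%:Z + j%:Z - i%:Z - n%:Z * d%:Z) i *: 'X^d.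

Definition Mtilde : int -> int -> F := unfold_mx n Mhat.

End LoopSchur.

(* The indeterminates, in the field of rational functions over C = R[i].       *)
Definition indet (R : realType) (m n : nat) :
    'M[{fraction {mpoly R[i][m * n]}}]_(m, n) :=
  \matrix_(i, j) tofrac 'X_(mxvec_index i j).

Definition row_set (l : nat) (mu : seq nat) (r : int) : seq int :=
  [seq (part (conj_part mu) c)%:Z - c%:Z + 1 + r | c <- iota 1 l].

Definition col_set (m l : nat) (la : seq nat) (r : int) : seq int :=
  [seq (part (conj_part la) c)%:Z - c%:Z + 1 + r - m%:Z | c <- iota 1 l].

(* Main.v *)
Require Import Defs.
From mathcomp Require Import all_boot all_order all_algebra.
From mathcomp Require Import fraction reals complex mpoly.
From mathcomp Require Import perm zify ring.

(* The dual Jacobi-Trudi formula writes a loop skew Schur function as a minor  *)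
(* of the periodic Z x Z matrix [loop_mx] of loop elementary functions: adding *)
(* one variable at a time, multilinearity expands the determinant into moves   *)
(* of the row indices to the right, and the moves that never make two indices  *)
(* collide are the semistandard tableaux.                                      *)
(* Cut [loop_mx] into n x n blocks A_d.  The bottom left minors of A_0 are the *)
(* shape invariants, hence nonzero, so some upper unitriangular constant       *)
(* matrices u and v bring A_0 to the antidiagonal form M'.  The corner color   *)
(* condition says that the row (resp. column) set of the minor is closed under *)
(* going down (resp. left) within each block, and such minors do not change    *)
(* when all A_d are replaced by u A_d v.  It remains to see that u A_d v is    *)
(* the coefficient of t^d in Mhat: each of its entries, times two shape        *)
(* invariants, is a block triangular minor of the same kind, equal to the loop *)
(* skew Schur function in the numerator of the reduced Q-invariant.            *)

Set Implicit Arguments.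
Unset Strict Implicit.
Unset Printing Implicit Defensive.

Import Order.TTheory GRing.Theory Num.Theory.
Local Open Scope ring_scope.

(** * Column lengths and determinants of loop elementary functions *)

(** Both sides equal the same minor of [loop_mx]. For the left side this is the dual Jacobi-Trudi
    formula [loop_schur_det]. A column of a tableau is read as a path that starts at the color of
    its top cell and moves by one at each step v occurring in the column; rows increase weakly
    exactly when the positions of the paths stay strictly decreasing. [loop_elem_det] sums over such
    families of paths, and [sum_ssyt_path] matches them with tableaux.

    For the right side, let A_d be the blocks of [loop_mx]. Gaussian elimination ([pivot_step],
    [unipotent_antidiag]) gives unitriangular u and v with u A_0 v = M'. The antidiagonal pivots are
    forced: the bottom left minors of A_0 are shape invariants and survive the elimination
    ([shape_inv_det_conj]), so each pivot is, up to sign, a quotient of two consecutive ones. The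
    same invariance, applied to a block triangular minor, computes the entries of u A_d v for d > 0
    ([conj_loop_schur]), and these are the coefficients of [Mhat] ([coef_Mhat]). The corner colors
    make the two index sets closed ([row_closed_corners], [col_closed_corners]), so
    [det_unfolded_uunitri] exchanges A_d and u A_d v inside the minor.

    This argument works over any field where the shape invariants are nonzero ([loop_schur_minor]);
    [loop_schur_indet_neq0] provides this for indeterminates. *)

Definition col_len (la : seq nat) (c : nat) : nat := count (leq c) la.

(** Both sides say that the cell (a, c) lies in the diagram. Through this equivalence shapes are
    handled by column lengths. *)
Lemma leq_part_col_len (la : seq nat) (a c : nat) :
  sorted geq la -> (0 < a)%N -> (0 < c)%N ->
  (c <= part la a)%N = (a <= col_len la c)%N.
Proof.
rewrite /part /col_len => srt_la a_gt0 c_gt0.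
elim: la a srt_la a_gt0 => [|x s IHs] a /=; first by rewrite nth_nil; lia.
rewrite path_sortedE; last by move=> u v w; rewrite /geq /=; lia.
move=> /andP[/allP s_le_x srt_s] a_gt0.
have s_small : (x < c)%N -> count (leq c) s = 0%N.
  move=> x_lt_c; apply/eqP; rewrite -leqn0 leqNgt -has_count.
  by apply/hasPn => y /s_le_x; rewrite /geq /=; lia.
case: a a_gt0 => [//|[|a]] _ /=.
  by case: (leqP c x) => // /s_small ->.
rewrite (IHs a.+1) //; case: (leqP c x) => [_ | /s_small ->]; lia.
Qed.

Lemma mem_skew_cells (la mu : seq nat) (a c : nat) :
  sorted geq la -> sorted geq mu ->
  ((a, c) \in skew_cells la mu)
  = (0 < c)%N && (col_len mu c < a <= col_len la c)%N.
Proof.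
move=> srt_la srt_mu; apply/allpairsPdep/idP => /= [[a' [c' []]] | ].
  rewrite !mem_iota => a'_la c'_row [-> ->].
  have := leq_part_col_len (a := a') (c := c') srt_la.
  have := leq_part_col_len (a := a') (c := c') srt_mu.
  lia.
move=> /and3P[c_gt0 lt_mu_a le_a_la]; exists a, c.
have a_gt0 : (0 < a)%N by lia.
have size_la : (col_len la c <= size la)%N by apply: count_size.
have := leq_part_col_len srt_la a_gt0 c_gt0.
have := leq_part_col_len srt_mu a_gt0 c_gt0.
by rewrite !mem_iota; split=> //; lia.
Qed.

Lemma col_len_part_sub (la mu : seq nat) (c : nat) :
  sorted geq la -> sorted geq mu -> part_sub mu la -> (0 < c)%N ->
  (col_len mu c <= col_len la c)%N.
Proof.
move=> srt_la srt_mu sub c_gt0; case: (posnP (col_len mu c)) => [-> //|col_gt0].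
have := leq_part_col_len srt_mu col_gt0 c_gt0.
have := leq_part_col_len srt_la col_gt0 c_gt0.
have := sub (col_len mu c); lia.
Qed.

Lemma col_len_anti (la : seq nat) (c c' : nat) :
  (c <= c')%N -> (col_len la c' <= col_len la c)%N.
Proof. by move=> le_cc'; apply: sub_count => x /=; apply: leq_trans. Qed.

Lemma part_conj_part (la : seq nat) (c : nat) :
  sorted geq la -> (0 < c)%N -> part (conj_part la) c = col_len la c.
Proof.
move=> srt_la; case: c => // c _; rewrite {1}/part /conj_part /=.
case: (ltnP c (part la 1)) => c_la.
  by rewrite (nth_map 0%N) ?size_iota // nth_iota.
rewrite nth_default ?size_map ?size_iota //.
have := leq_part_col_len (a := 1%N) (c := c.+1) srt_la; lia.
Qed.

(* [loop_elem X m a b] is the loop elementary function e_(b - a) in the m      *)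
(* variables X 0, ..., X m.-1, the colors of its factors being a, ..., b - 1. *)
Fixpoint loop_elem (F : fieldType) (X : nat -> int -> F) (m : nat) (a b : int) :
    F :=
  if m is m'.+1 then
    loop_elem (fun v => X v.+1) m' a b
    + X 0%N a * loop_elem (fun v => X v.+1) m' (a + 1) b
  else (a == b)%:R.

Definition decreasing (l : nat) (a : 'I_l -> int) : bool :=
  [forall c : 'I_l, forall c' : 'I_l, (c < c')%N ==> (a c' < a c)].

Lemma decreasingP (l : nat) (a : 'I_l -> int) :
  reflect (forall c c' : 'I_l, (c < c')%N -> a c' < a c) (decreasing a).
Proof.
apply: (iffP forallP) => [dec c c' | dec c].
  by have /forallP/(_ c')/implyP := dec c.
by apply/forallP => c'; apply/implyP/dec.
Qed.

Lemma eq_decreasing (l : nat) (a b : 'I_l -> int) :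
  a =1 b -> decreasing a = decreasing b.
Proof.
by move=> eq_ab; apply/decreasingP/decreasingP => dec c c' /dec; rewrite !eq_ab.
Qed.

(** A strictly increasing self-map dominates the identity; the same bound for its conjugate by
    [rev_ord] gives the reverse inequality. *)
Lemma increasing_ord_id (l : nat) (s : 'I_l -> 'I_l) :
  (forall i j : 'I_l, (i < j)%N -> (s i < s j)%N) -> forall i, s i = i.
Proof.
have ge_id (t : 'I_l -> 'I_l) :
    (forall i j : 'I_l, (i < j)%N -> (t i < t j)%N) -> forall i : 'I_l, (i <= t i)%N.
  move=> t_mono [i lt_il]; elim: i lt_il => [//|i IHi] lt_il /=.
  apply: leq_ltn_trans (IHi (ltnW lt_il)) _; exact: t_mono.
move=> s_mono i; apply/val_inj/eqP; rewrite eqn_leq (ge_id _ s_mono) andbT.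
have := ge_id (fun j => rev_ord (s (rev_ord j))) _ (rev_ord i).
rewrite rev_ordK /=; have := ltn_ord i; have := ltn_ord (s i).
move=> lt_s lt_i /(_ _) le_rev; suff: (l - i.+1 <= l - (s i).+1)%N by lia.
apply: le_rev => j j' lt_jj' /=.
have : (s (rev_ord j') < s (rev_ord j))%N.
  by apply: s_mono => /=; have := ltn_ord j'; lia.
by have := ltn_ord (s (rev_ord j)); lia.
Qed.

(** * Determinants of loop elementary functions as sums over families of paths *)

Section LoopElementaryDet.

Variable F : fieldType.

Lemma det_row_sum (l : nat) (A B : 'I_l -> 'I_l -> F) (x : 'I_l -> F) :
  \det (\matrix_(i, j) (A i j + x i * B i j))
  = \sum_(e : {ffun 'I_l -> bool})
      (\prod_i (if e i then x i else 1))
      * \det (\matrix_(i, j) (if e i then B i j else A i j)).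
Proof.
rewrite /determinant; under [RHS]eq_bigr do rewrite big_distrr.
rewrite [RHS]exchange_big /=; apply: eq_bigr => s _.
under eq_bigr do rewrite mxE.
transitivity ((-1) ^+ s * \prod_i \sum_(b : bool)
    (if b then x i * B i (s i) else A i (s i))).
  by congr (_ * _); apply: eq_bigr => i _; rewrite big_bool /= addrC.
rewrite bigA_distr_bigA big_distrr /=; apply: eq_bigr => e _.
rewrite mulrCA -big_split /=; congr (_ * _); apply: eq_bigr => i _.
by rewrite mxE; case: (e i); rewrite ?mul1r.
Qed.

(** If every a i occurs among the b j, monotonicity forces the matching to be the identity;
    otherwise some row is zero. This is the case of no variables in [loop_elem_det]. *)
Lemma det_indicator (l : nat) (a b : 'I_l -> int) :
  decreasing a -> decreasing b ->
  \det (\matrix_(i, j) (a i == b j)%:R : 'M[F]_l) = [forall c, a c == b c]%:R.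
Proof.
move=> /decreasingP dec_a /decreasingP dec_b.
have inj_dec (f : 'I_l -> int) :
    (forall c c' : 'I_l, (c < c')%N -> f c' < f c) -> injective f.
  move=> dec c c' eq_f; apply/val_inj; case: (ltngtP c c') => // /dec;
  by rewrite eq_f ltxx.
have [/forallP eq_ab|neq_ab] := boolP [forall c, a c == b c].
  suff -> : \matrix_(i, j) (a i == b j)%:R = 1%:M :> 'M[F]_l by rewrite det1.
  apply/matrixP => i j; rewrite !mxE -(eqP (eq_ab j)).
  by rewrite (inj_eq (inj_dec _ dec_a)).
have [/existsP[i /forallP a_i]|] := boolP [exists i, [forall j, a i != b j]].
  rewrite (expand_det_row _ i) big1 // => j _.
  by rewrite mxE (negPf (a_i j)) mul0r.
rewrite negb_exists => /forallP all_ex; case/negP: neq_ab.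
have ex_s i : {j | a i = b j}.
  apply/sig_eqW; have := all_ex i; rewrite negb_forall.
  by case/existsP=> j /negPn/eqP; exists j.
pose s i := sval (ex_s i); have sE i : a i = b (s i) := svalP (ex_s i).
have s_mono (i j : 'I_l) : (i < j)%N -> (s i < s j)%N.
  move=> /dec_a; rewrite !sE; case: (ltngtP (s i) (s j)) => // [/dec_b|eq_s].
    by move=> /lt_trans lt /lt; rewrite ltxx.
  by rewrite (val_inj eq_s) ltxx.

by apply/forallP => i; rewrite sE (increasing_ord_id s_mono) eqxx.
Qed.

(* A family of [l] paths: at step [v] the path [c] moves right iff [e v c],    *)
(* i.e. iff the entry [v] occurs in column [c] of the tableau.                 *)
Definition path_pos (m l : nat) (a : 'I_l -> int)
    (e : {ffun 'I_m -> {ffun 'I_l -> bool}}) (v : nat) (c : 'I_l) : int :=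
  a c + (\sum_(i < m | (i < v)%N) (e i c : nat))%N%:Z.

Definition path_valid (m l : nat) (a b : 'I_l -> int)
    (e : {ffun 'I_m -> {ffun 'I_l -> bool}}) : bool :=
  [forall v : 'I_m.+1, decreasing (path_pos a e v)]
  && [forall c, path_pos a e m c == b c].

Definition path_weight (X : nat -> int -> F) (m l : nat) (a : 'I_l -> int)
    (e : {ffun 'I_m -> {ffun 'I_l -> bool}}) : F :=
  \prod_(v < m) \prod_(c < l) (if e v c then X v (path_pos a e v c) else 1).

Definition ffun_cons (T : Type) (m : nat) (y : T) (f : {ffun 'I_m -> T}) :
    {ffun 'I_m.+1 -> T} :=
  [ffun i => if unlift ord0 i is Some j then f j else y].

Lemma ffun_cons0 (T : Type) (m : nat) (y : T) (f : {ffun 'I_m -> T}) :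
  ffun_cons y f ord0 = y.
Proof. by rewrite ffunE unlift_none. Qed.

Lemma ffun_consS (T : Type) (m : nat) (y : T) (f : {ffun 'I_m -> T}) i :
  ffun_cons y f (lift ord0 i) = f i.
Proof. by rewrite ffunE liftK. Qed.

Lemma sum_ffun_cons (T : finType) (m : nat) (G : {ffun 'I_m.+1 -> T} -> F) :
  \sum_f G f = \sum_y \sum_f G (ffun_cons y f).
Proof.
rewrite pair_bigA /= (reindex (fun p => ffun_cons p.1 p.2)) //=.
exists (fun f => (f ord0, [ffun i => f (lift ord0 i)])) => [[y f] _ | f _] /=.
  by rewrite ffun_cons0; congr (_, _); apply/ffunP => i; rewrite ffunE ffun_consS.
by apply/ffunP => i; rewrite ffunE; case: unliftP => [j|] ->; rewrite ?ffunE.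
Qed.

Lemma path_pos0 (m l : nat) (a : 'I_l -> int) e c : @path_pos m l a e 0 c = a c.
Proof. by rewrite /path_pos big1 ?addr0 // => i; rewrite ltn0. Qed.

Lemma path_pos_cons (m l : nat) (a : 'I_l -> int) y
    (e : {ffun 'I_m -> {ffun 'I_l -> bool}}) v c :
  path_pos a (ffun_cons y e) v.+1 c
  = path_pos (fun c => a c + (y c : nat)%:Z) e v c.
Proof.
rewrite /path_pos big_mkcond big_ord_recl /= ffun_cons0 PoszD addrA.
congr (_ + Posz _); rewrite [RHS]big_mkcond; apply: eq_bigr => i _.
by rewrite ffun_consS.
Qed.

(** Induction on the number of variables. Paths move by at most one per step, so they cannot change
    order without first sharing a position, and then two rows of the determinant coincide. Hence
    only strictly decreasing families survive, all with sign +1. *)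
Lemma loop_elem_det (m l : nat) (X : nat -> int -> F) (a b : 'I_l -> int) :
  decreasing a -> decreasing b ->
  \det (\matrix_(i, j) loop_elem X m (a i) (b j))
  = \sum_(e : {ffun 'I_m -> {ffun 'I_l -> bool}} | path_valid a b e)
      path_weight X a e.
Proof.
move=> dec_a dec_b; elim: m X a dec_a => [|m IHm] X a dec_a.
  rewrite det_indicator // big_mkcond /=.
  have one_path (e e' : {ffun 'I_0 -> {ffun 'I_l -> bool}}) : e = e'.
    by apply/ffunP => -[].
  pose e0 : {ffun 'I_0 -> {ffun 'I_l -> bool}} := [ffun=> [ffun=> false]].
  rewrite (bigD1 e0) //= big1 => [|e /eqP[]]; last exact: one_path.
  rewrite addr0 /path_weight big_ord0 /path_valid.
  have -> : [forall v : 'I_1, decreasing (path_pos a e0 v)].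
    apply/forallP => v; rewrite ord1.
    by rewrite (eq_decreasing (b := a)) // => c; rewrite path_pos0.
  under eq_forallb do rewrite path_pos0.
  by case: [forall _, _].
(* Here [y] records which paths move at the first step. *)
rewrite det_row_sum [RHS]big_mkcond sum_ffun_cons; apply: eq_bigr => y _.
pose ay c := a c + (y c : nat)%:Z.
under eq_mx => i j.
  rewrite (_ : (if _ then _ else _) = loop_elem (fun v => X v.+1) m (ay i) (b j)).
    over.
  by rewrite /ay; case: (y i); rewrite ?addr0.
have [dec_ay|ndec_ay] := boolP (decreasing ay).
  rewrite IHm // big_distrr big_mkcond /=; apply: eq_bigr => e _.
  have -> : path_valid a b (ffun_cons y e) = path_valid ay b e.
    rewrite /path_valid; congr (_ && _).
      apply/forallP/forallP => [dec v | dec v].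
        have := dec (lift ord0 v); rewrite /= /bump /= add1n.
        by under eq_decreasing do rewrite path_pos_cons.
      case: (unliftP ord0 v) => [j|] ->.
        rewrite /= /bump /= add1n; under eq_decreasing do rewrite path_pos_cons.
        exact: dec.
      by under eq_decreasing do rewrite path_pos0.
    by under eq_forallb do rewrite path_pos_cons.
  case: ifP => // _; rewrite /path_weight big_ord_recl /=; congr (_ * _).
    by apply: eq_bigr => c _; rewrite ffun_cons0 path_pos0.
  apply: eq_bigr => v _; apply: eq_bigr => c _.
  by rewrite ffun_consS /bump /= add1n path_pos_cons.
rewrite [RHS]big1 => [|e _]; last first.
  case: ifP => // /andP[/forallP dec _]; case/negP: ndec_ay.
  have := dec (lift ord0 ord0); rewrite /= /bump /=.
  under eq_decreasing do rewrite path_pos_cons path_pos0.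
  done.
(* Strictly decreasing integers, each moved by 0 or 1, stop being strictly decreasing only by a
   coincidence. *)
have [c [c' [lt_cc' eq_ay]]] : exists c c' : 'I_l, (c < c')%N /\ ay c = ay c'.
  move: ndec_ay; rewrite negb_forall => /existsP[c]; rewrite negb_forall.
  case/existsP=> c'; rewrite negb_imply => /andP[lt_cc' nlt]; exists c, c'.
  split=> //; have /decreasingP/(_ c c' lt_cc') := dec_a; move: nlt; rewrite /ay.
  by case: (y c); case: (y c'); lia.
rewrite (determinant_alternate (i1 := c) (i2 := c')) ?mulr0 //.
  by rewrite neq_ltn lt_cc'.
by move=> j; rewrite !mxE eq_ay.
Qed.

End LoopElementaryDet.

(** * Semistandard tableaux as families of paths *)

Lemma decreasing_gap (l : nat) (a : 'I_l -> int) (c c' : 'I_l) :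
  decreasing a -> (c <= c')%N -> a c' + (c'%:Z - c%:Z) <= a c.
Proof.
move=> /decreasingP dec_a; case: c' => c' lt_c'l /= le_cc'.
elim: c' lt_c'l le_cc' => [|c' IHc'] lt_c'l le_cc'.
  suff -> : c = Ordinal lt_c'l by rewrite /= subrr addr0.
  by apply/val_inj => /=; lia.
case: (leqP c c') => [le_cc|lt_cc]; last first.
  suff -> : c = Ordinal lt_c'l by rewrite /= subrr addr0.
  by apply/val_inj => /=; lia.
have := IHc' (ltnW lt_c'l) le_cc.
have := dec_a (Ordinal (ltnW lt_c'l)) (Ordinal lt_c'l) (ltnSn _); lia.
Qed.

Section Tableaux.

Variables (m l : nat) (la mu : seq nat) (r : int).
Hypotheses (la_l : (part la 1 <= l)%N).
Hypotheses (srt_la : sorted geq la) (srt_mu : sorted geq mu).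
Hypothesis sub_mu_la : part_sub mu la.

Local Notation cell := (seq_sub (skew_cells la mu)).
Local Notation path := {ffun 'I_m -> {ffun 'I_l -> bool}}.
Definition cell_row (s : cell) : nat := (val s).1.
Definition cell_col (s : cell) : nat := (val s).2.
Local Notation row := cell_row.
Local Notation col := cell_col.

Implicit Types (s t : cell) (c : 'I_l) (e : path).

(** For a nonempty column c + 1, [top] is the color of its first cell and [bottom] is one more than
    the color of its last cell, before reduction mod n. *)
Let top (c : 'I_l) : int := (col_len mu c.+1)%:Z - c%:Z + r.
Let bottom (c : 'I_l) : int := (col_len la c.+1)%:Z - c%:Z + r.

Lemma cellP (s : cell) :
  [/\ (0 < col s)%N, (col s <= l)%N & (col_len mu (col s) < row s <= col_len la (col s))%N].
Proof.
have := valP s; rewrite /row /col; case: (val s) => a c /=; rewrite mem_skew_cells //.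
move=> /and3P[c_gt0 lt_a le_a]; split; rewrite ?lt_a //.
apply: leq_trans la_l; rewrite leq_part_col_len //; lia.
Qed.

Lemma cell_ex (a : nat) (c : nat) :
  (col_len mu c.+1 < a <= col_len la c.+1)%N ->
  exists s : cell, row s = a /\ col s = c.+1.
Proof.
move=> a_c; have a_in : (a, c.+1) \in skew_cells la mu by rewrite mem_skew_cells.
by exists (SeqSub a_in).
Qed.

Lemma cell_inj (s t : cell) : row s = row t -> col s = col t -> s = t.
Proof.
move=> eq_row eq_col; apply/val_inj.
by rewrite (surjective_pairing (val s)) -/(row s) -/(col s) eq_row eq_col -surjective_pairing.
Qed.

Lemma col_lt (s : cell) : ((col s).-1 < l)%N.
Proof. by have [] := cellP s; lia. Qed.

Definition col_ord (s : cell) : 'I_l := Ordinal (col_lt s).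

Lemma col_ordE (s : cell) : (col_ord s).+1 = col s.
Proof. by have [] := cellP s; rewrite /=; lia. Qed.

Lemma card_col_upto (c : 'I_l) (a : nat) :
  (a <= col_len la c.+1)%N ->
  #|[pred t : cell | (col t == c.+1) && (row t <= a)%N]| = (a - col_len mu c.+1)%N.
Proof.
elim: a => [|a IHa] le_a.
  by apply: eq_card0 => t; rewrite !inE; have [] := cellP t; lia.
have [le_mu|lt_mu] := leqP a.+1 (col_len mu c.+1).
  transitivity 0%N; last lia.
  apply: eq_card0 => t; rewrite !inE; have [_ _] := cellP t.
  by case: eqP => // ->; lia.
have [|s [row_s col_s]] := @cell_ex a.+1 c; first by rewrite lt_mu.
rewrite (cardD1 s) !inE ?row_s ?col_s eqxx leqnn subSn; last by lia.
rewrite /= add1n -IHa; last by lia.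
congr _.+1; apply: eq_card => t; rewrite !inE.
have [->|ne_ts] := eqVneq t s; first by rewrite ?row_s ?col_s ltnn andbF.
have [col_t|] := eqVneq (col t) c.+1; last by rewrite andbF.
rewrite /= leq_eqVlt ltnS orb_idl // => /eqP row_t.
by case/eqP: ne_ts; apply: cell_inj; rewrite ?row_s ?col_s.
Qed.

Definition tab_path (T : {ffun cell -> 'I_m}) : path :=
  [ffun v => [ffun c : 'I_l => [exists s : cell, (col s == c.+1) && (T s == v)]]].

(** The number of moves of path c before step v, that is, its displacement in [path_pos]. *)
Let height (e : path) (v : nat) (c : 'I_l) : nat :=
  (\sum_(i < m | (i < v)%N) (e i c : nat))%N.

Lemma height_lt e (v : 'I_m) (v' : nat) c :
  e v c -> (v < v')%N -> (height e v c < height e v' c)%N.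
Proof.
move=> e_vc lt_vv'; rewrite /height [X in (_ < X)%N](bigD1 v) //= e_vc add1n ltnS.
rewrite big_mkcond [X in (_ <= X)%N]big_mkcond; apply: leq_sum => i _.
case: ifP => // lt_iv; case: ifP => // /negP[]; rewrite (ltn_trans lt_iv lt_vv').
by apply: contraTneq lt_iv => ->; rewrite ltnn.
Qed.

Lemma height_le e v v' c : (v <= v')%N -> (height e v c <= height e v' c)%N.
Proof.
move=> le_vv'; rewrite /height big_mkcond [X in (_ <= X)%N]big_mkcond.
apply: leq_sum => i _; case: ifP => // lt_iv; case: ifP => // /negP[]; lia.
Qed.

Lemma heightS e (v : 'I_m) c : height e v.+1 c = (height e v c + e v c)%N.
Proof.
rewrite /height (bigD1 v) //= addnC; congr (_ + _)%N; apply: eq_bigl => i.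
rewrite ltnS [in RHS]ltn_neqAle -(inj_eq val_inj) andbC //.
Qed.

Lemma height_inj e (v v' : 'I_m) c :
  e v c -> e v' c -> height e v c = height e v' c -> v = v'.
Proof.
move=> e_v e_v' eq_h; apply/val_inj; case: (ltngtP v v') => // lt.
  by have := height_lt e_v lt; rewrite eq_h ltnn.
by have := height_lt e_v' lt; rewrite eq_h ltnn.
Qed.

Lemma height_ex e c (k : nat) :
  (k < height e m c)%N -> exists v : 'I_m, e v c && (height e v c == k).
Proof.
move=> lt_k; have ex_v : exists v, (k < height e v c)%N by exists m.
case: (ex_minnP ex_v) => -[|v] lt_kv v_min.
  by move: lt_kv; rewrite /height big1 // => i; rewrite ltn0.
have lt_vm : (v < m)%N by apply: v_min.
have le_v : (height e v c <= k)%N.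
  by rewrite leqNgt; apply/negP => /v_min; rewrite ltnn.
exists (Ordinal lt_vm); move: lt_kv; rewrite (heightS _ (Ordinal lt_vm)) /=.
by case: (e _ c) => /=; lia.
Qed.

Section SSYT.

Variable T : {ffun cell -> 'I_m}.
Hypothesis T_ssyt : is_ssyt T.

Lemma ssyt_row s t : row s = row t -> (col s < col t)%N -> (T s <= T t)%N.
Proof.
move=> eq_row lt_col; have /forallP/(_ s)/forallP/(_ t)/andP[/implyP le_T _] := T_ssyt.
by apply: le_T; rewrite -/(row s) -/(row t) eq_row eqxx.
Qed.

Lemma ssyt_col s t : col s = col t -> (row s < row t)%N -> (T s < T t)%N.
Proof.
move=> eq_col lt_row; have /forallP/(_ s)/forallP/(_ t)/andP[_ /implyP lt_T] := T_ssyt.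
by apply: lt_T; rewrite -/(col s) -/(col t) eq_col eqxx.
Qed.

Lemma ssyt_col_ltn s t : col s = col t -> (T s < T t)%N = (row s < row t)%N.
Proof.
move=> eq_col; case: (ltngtP (row s) (row t)) => [lt|lt|eq].
- exact: ssyt_col.
- by have := ssyt_col (esym eq_col) lt; lia.
- by rewrite (cell_inj eq eq_col) ltnn.
Qed.

(** A value occurs at most once in a column, so counting the values below v that occur amounts to
    counting cells. *)
Lemma height_tab_path v c :
  height (tab_path T) v c = #|[pred t : cell | (col t == c.+1) && (T t < v)%N]|.
Proof.
rewrite -sum1_card (partition_big T (fun i => (i < v)%N)) /=; last by move=> t /andP[].
apply: eq_bigr => i lt_iv; rewrite !ffunE.
case: existsP => [[s /andP[/eqP col_s /eqP T_s]]|no_s] /=.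
  rewrite (big_pred1 s) // => t; rewrite !inE; apply/idP/eqP => [|->]; last first.
    by rewrite col_s T_s !eqxx lt_iv.
  move=> /andP[/andP[/eqP col_t _] /eqP T_t].
  have eq_col : col t = col s by rewrite col_t.
  have := ssyt_col_ltn eq_col; have := ssyt_col_ltn (esym eq_col).
  by rewrite T_t T_s ltnn => h1 h2; apply: cell_inj => //; lia.
rewrite big_pred0 // => t; apply/negP => /andP[/andP[col_t _] T_t].
by case: no_s; exists t; rewrite T_t andbT.
Qed.

Lemma height_tab_path_cell s c :
  col s = c.+1 -> height (tab_path T) (T s) c = (row s - (col_len mu c.+1).+1)%N.
Proof.
move=> col_s; have [_ _] := cellP s; rewrite col_s => row_s.
rewrite height_tab_path subnS predn_sub -card_col_upto; last by lia.
apply: eq_card => t; rewrite !inE; case: eqP => // col_t /=.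
by rewrite ssyt_col_ltn ?col_s //; lia.
Qed.

(** Columns increase strictly, so the entries below v fill an initial segment of the column, of
    length [height]. *)
Lemma ssyt_lt_height s c v :
  col s = c.+1 -> (T s < v)%N = (row s <= col_len mu c.+1 + height (tab_path T) v c)%N.
Proof.
move=> col_s; have [_ _] := cellP s; rewrite col_s => row_s.
rewrite height_tab_path; case: (ltnP (T s) v) => [lt_v|le_v]; apply/esym.
  rewrite -leq_subLR -card_col_upto; last by lia.
  apply/subset_leq_card/subsetP => t; rewrite !inE => /andP[/eqP col_t le_ts].
  rewrite col_t eqxx /=; apply: leq_trans lt_v; rewrite ltnS leqNgt.
  by rewrite ssyt_col_ltn ?col_s //; lia.
apply/negbTE; rewrite -ltnNge -[row s]prednK; last by lia.
rewrite ltnS -leq_subRL; last by lia.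
rewrite -card_col_upto; last by lia.
apply/subset_leq_card/subsetP => t; rewrite !inE => /andP[/eqP col_t lt_tv].
have : (T t < T s)%N by apply: leq_trans lt_tv le_v.
by rewrite ssyt_col_ltn ?col_s // col_t eqxx /=; lia.
Qed.

(** Together with mu, the cells with entry below v form a partition shape; its weakly decreasing
    column lengths are the strictly decreasing positions. *)
Lemma path_valid_tab_path : path_valid top bottom (tab_path T).
Proof.
apply/andP; split; last first.
  apply/forallP => c; rewrite /path_pos -/(height _ _ _) height_tab_path.
  have -> : #|[pred t : cell | (col t == c.+1) && (T t < m)%N]|
            = (col_len la c.+1 - col_len mu c.+1)%N.
    rewrite -card_col_upto //; apply: eq_card => t; rewrite !inE ltn_ord.
    by case: eqP => //= <-; have [_ _ /andP[_ ->]] := cellP t.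
  have := @col_len_part_sub la mu c.+1 srt_la srt_mu sub_mu_la isT.
  by rewrite /top /bottom; lia.
apply/forallP => v; apply/decreasingP => c c' lt_cc'.
rewrite /path_pos -!/(height _ _ _) /top.
suff : (col_len mu c'.+1 + height (tab_path T) v c'
        <= col_len mu c.+1 + height (tab_path T) v c)%N by lia.
have le_mu : (col_len mu c'.+1 <= col_len mu c.+1)%N by apply: col_len_anti; lia.
have le_la : (col_len la c'.+1 <= col_len la c.+1)%N by apply: col_len_anti; lia.
case: (posnP (height (tab_path T) v c')) => [->|h_gt0]; first by lia.
(* Row [a] is the last one of column c' + 1 filled with entries below v. If the cell of column c + 1
   in that row is outside mu, its entry is at most that of the cell to its right, hence also below
   v. *)
set a := (_ + height _ _ c')%N.
have le_a : (a <= col_len la c'.+1)%N.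
  have le_mu_la := @col_len_part_sub la mu c'.+1 srt_la srt_mu sub_mu_la isT.
  rewrite /a -leq_subRL // -card_col_upto // height_tab_path.
  apply/subset_leq_card/subsetP => t; rewrite !inE => /andP[/eqP col_t _].
  by rewrite col_t eqxx -col_t; have [_ _ /andP[_ ->]] := cellP t.
case: (leqP a (col_len mu c.+1)) => [|lt_a]; first by lia.
have [|s [row_s col_s]] := @cell_ex a c; first by lia.
have [|s' [row_s' col_s']] := @cell_ex a c'; first by rewrite /a; lia.
have := @ssyt_lt_height s c v; rewrite ?row_s ?col_s /= => <- //.
have : (T s' < v)%N by rewrite (@ssyt_lt_height s' c' v) ?row_s' ?col_s'.
by apply: leq_ltn_trans; apply: ssyt_row; rewrite ?row_s ?col_s ?row_s' ?col_s'.
Qed.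

(** A move of path c at step v is the cell of column c + 1 with entry v, and the position before the
    move is the color of that cell. *)
Lemma path_weight_tab_path (F : fieldType) (X : nat -> int -> F) :
  path_weight X top (tab_path T) = \prod_s X (T s) (content (val s) + r).
Proof.
rewrite /path_weight pair_bigA /= -big_mkcond /=.
pose f s := (T s, col_ord s).
have f_inj : {in predT &, injective f}.
  move=> s t _ _ eq_f; have eq_T : T s = T t := congr1 fst eq_f.
  have eq_col : col_ord s = col_ord t := congr1 snd eq_f.
  have eq_c : col s = col t by rewrite -!col_ordE eq_col.
  have := ssyt_col_ltn eq_c; have := ssyt_col_ltn (esym eq_c).
  by rewrite eq_T ltnn => h1 h2; apply: cell_inj => //; lia.
transitivity (\prod_(p in f @: predT) X p.1 (path_pos top (tab_path T) p.1 p.2)).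
  apply: eq_bigl => -[v c]; rewrite !ffunE; apply/existsP/imsetP => /=.
    move=> [s /andP[/eqP col_s /eqP T_s]]; exists s => //; rewrite /f T_s.
    by congr (_, _); apply/val_inj/eq_add_S; rewrite col_ordE.
  by move=> [s _ [-> ->]]; exists s; rewrite col_ordE !eqxx.
rewrite big_imset //; apply: eq_bigr => s _ /=; congr (X _ _).
rewrite /path_pos -/(height _ _ _) height_tab_path_cell ?col_ordE //.
have [_ _] := cellP s; have := col_ordE s.
by rewrite /top /content -/(row s) -/(col s) => <-; lia.
Qed.

End SSYT.

Lemma tab_path_inj : {in @is_ssyt m la mu &, injective tab_path}.
Proof.
move=> T T' T_ssyt T'_ssyt eq_path; apply/ffunP => s.
have in_path (U : {ffun cell -> 'I_m}) : tab_path U (U s) (col_ord s).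
  by rewrite !ffunE; apply/existsP; exists s; rewrite col_ordE !eqxx.
apply: (@height_inj (tab_path T) _ _ (col_ord s)) => //.
  by rewrite eq_path in_path.
rewrite (height_tab_path_cell T_ssyt) ?col_ordE // eq_path.
by rewrite (height_tab_path_cell T'_ssyt) ?col_ordE.
Qed.

(** The k-th cell of a column receives the step of the k-th move of its path. If in some row the
    cell on the right had the smaller entry, then just after that step its column would be longer
    than the one on the left, against the decreasing positions. *)
Lemma tab_path_surj e :
  path_valid top bottom e -> exists2 T, is_ssyt T & e = tab_path T.
Proof.
move=> /andP[/forallP dec /forallP end_e].
have heightm c : height e m c = (col_len la c.+1 - col_len mu c.+1)%N.
  have := end_e c; rewrite /path_pos -/(height _ _ _) /top /bottom.
  have := @col_len_part_sub la mu c.+1 srt_la srt_mu sub_mu_la isT; lia.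
have ex_T s : exists v : 'I_m, e v (col_ord s)
    && (height e v (col_ord s) == (row s - (col_len mu (col s)).+1)%N).
  apply: height_ex; rewrite heightm col_ordE; have [_ _] := cellP s; lia.
pose T := [ffun s => xchoose (ex_T s)].
have T_path s : e (T s) (col_ord s) by rewrite ffunE; have /andP[] := xchooseP (ex_T s).
have T_height s : height e (T s) (col_ord s) = (row s - (col_len mu (col s)).+1)%N.
  by rewrite ffunE; have /andP[_ /eqP] := xchooseP (ex_T s).
exists T.
  apply/forallP => s; apply/forallP => t.
  rewrite -/(row s) -/(row t) -/(col s) -/(col t).
  have [_ _ row_s] := cellP s; have [_ _ row_t] := cellP t.
  apply/andP; split; apply/implyP => /andP[/eqP eq_st lt_st]; last first.
    have eq_col : col_ord s = col_ord t by apply/val_inj/eq_add_S; rewrite !col_ordE.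
    rewrite ltnNge; apply/negP => le_ts.
    have := height_le e (col_ord s) le_ts.
    rewrite T_height eq_col T_height -eq_st; move: row_t; rewrite -eq_st; lia.
  rewrite leqNgt; apply/negP => lt_ts.
  have lt_m : ((T t).+1 < m.+1)%N by rewrite ltnS.
  have le_col : (col_ord s <= col_ord t)%N by rewrite -ltnS !col_ordE; lia.
  have /= := decreasing_gap (dec (Ordinal lt_m)) le_col.
  have := height_le e (col_ord s) lt_ts.
  rewrite /path_pos -!/(height _ _ _) (heightS _ (T t) (col_ord t)) T_path !T_height.
  have : (col_ord s).+1 = col s := col_ordE s.
  have : (col_ord t).+1 = col t := col_ordE t.
  have : col_ord s = (col s).-1 :> nat by [].
  have : col_ord t = (col t).-1 :> nat by [].
  by rewrite /top => E1 E2 E3 E4; rewrite E3 E4; move: (height _ _ _); lia.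
apply/ffunP => v; apply/ffunP => c; rewrite !ffunE; apply/idP/existsP.
  move=> e_vc; have := height_lt e_vc (ltn_ord v); rewrite heightm => lt_h.
  have [|s [row_s col_s]] := @cell_ex (col_len mu c.+1 + height e v c).+1 c; first by lia.
  have eq_c : col_ord s = c by apply/val_inj/eq_add_S; rewrite col_ordE ?row_s ?col_s.
  exists s; rewrite ?row_s ?col_s eqxx /=; apply/eqP.
  have := T_path s; have := T_height s; rewrite eq_c ?row_s ?col_s /= => h_s e_s.
  apply: (height_inj e_s e_vc); rewrite h_s; lia.
move=> [s /andP[/eqP col_s /eqP <-]].
suff <- : col_ord s = c by [].
by apply/val_inj/eq_add_S; rewrite col_ordE.
Qed.

Lemma sum_ssyt_path (F : fieldType) (X : nat -> int -> F) :
  \sum_(T : {ffun cell -> 'I_m} | is_ssyt T)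
    \prod_s X (T s) (content (val s) + r)
  = \det (\matrix_(c < l, c' < l) loop_elem X m (top c) (bottom c')).
Proof.
rewrite loop_elem_det; last 2 first.
- apply/decreasingP => c c' lt_cc'; have := col_len_anti mu (ltnW lt_cc' : (c.+1 <= c'.+1)%N).
  by rewrite /top; lia.
- apply/decreasingP => c c' lt_cc'; have := col_len_anti la (ltnW lt_cc' : (c.+1 <= c'.+1)%N).
  by rewrite /bottom; lia.
rewrite -(eq_bigr _ (fun T T_ssyt => path_weight_tab_path T_ssyt X)).
rewrite -(big_imset _ tab_path_inj); apply: eq_bigl => e.
apply/imsetP/idP => [[T T_ssyt ->] | /tab_path_surj[T T_ssyt ->]].
  exact: path_valid_tab_path.
by exists T.
Qed.

End Tableaux.

(** * Unfolded block matrices and unitriangular changes of basis *)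

Section LoopMatrix.

Variables (F : fieldType) (m n : nat) (x : 'M[F]_(m, n)).

(** The default 0 is for v >= m, which the m steps of [loop_elem] never read. *)
Definition loop_vars (v : nat) (a : int) : F :=
  if insub v is Some i then loop_var x i a else 0.

(* The unfolded matrix of loop elementary functions, before the unipotent      *)
(* change of basis that turns it into [Mtilde].                                *)
Definition loop_mx (a b : int) : F := loop_elem loop_vars m a (b + m%:Z).

Lemma loop_schur_det (l : nat) (r : int) (la mu : seq nat) :
  sorted geq la -> sorted geq mu -> part_sub mu la -> (part la 1 <= l)%N ->
  loop_schur x r la mu
  = \det (\matrix_(c < l, c' < l)
            loop_mx ((col_len mu c.+1)%:Z - c%:Z + r)
                    ((col_len la c'.+1)%:Z - c'%:Z + r - m%:Z)).
Proof.
move=> srt_la srt_mu sub_mu_la la_l.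
transitivity (\sum_(T : {ffun seq_sub (skew_cells la mu) -> 'I_m} | is_ssyt T)
    \prod_s loop_vars (T s) (content (val s) + r)).
  by apply: eq_bigr => T _; apply: eq_bigr => s _; rewrite /loop_vars valK.
rewrite (sum_ssyt_path _ _ la_l) //; congr (\det _).
by apply/matrixP => c c'; rewrite !mxE /loop_mx subrK.
Qed.

Lemma loop_vars_periodic v a : loop_vars v (a + n%:Z) = loop_vars v a.
Proof.
rewrite /loop_vars; case: insubP => // i _ _; apply: eq_bigl => j.
have -> : a + n%:Z - i.+1%:Z + 1 = a - i.+1%:Z + 1 + n%:Z by ring.
by rewrite modzDr.
Qed.

Lemma loop_elem_periodic (X : nat -> int -> F) (k : nat) (d : int) a b :
  (forall v a, X v (a + d) = X v a) ->
  loop_elem X k (a + d) (b + d) = loop_elem X k a b.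
Proof.
elim: k X a => [|k IHk] X a per /=; first by rewrite (inj_eq (addIr d)).
by rewrite addrAC per !IHk // => v c; apply: per.
Qed.

Lemma loop_elem_lt (X : nat -> int -> F) (k : nat) a b :
  b < a -> loop_elem X k a b = 0.
Proof.
elim: k X a => [|k IHk] X a lt_ba /=; first by case: eqP => // ?; lia.
by rewrite !IHk ?mulr0 ?addr0 //; lia.
Qed.

Lemma loop_elem_gt (X : nat -> int -> F) (k : nat) a b :
  a + k%:Z < b -> loop_elem X k a b = 0.
Proof.
elim: k X a => [|k IHk] X a lt_ab /=; first by case: eqP => // ?; lia.
by rewrite !IHk ?mulr0 ?addr0 //; lia.
Qed.

Lemma loop_elem_diag (X : nat -> int -> F) (k : nat) a : loop_elem X k a a = 1.
Proof.
elim: k X => [|k IHk] X /=; first by rewrite eqxx.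
by rewrite IHk loop_elem_lt ?mulr0 ?addr0 //; lia.
Qed.

Lemma loop_mx_periodic (d : int) a b :
  loop_mx (a + n%:Z * d) (b + n%:Z * d) = loop_mx a b.
Proof.
rewrite /loop_mx addrAC; apply: loop_elem_periodic => v.
have periodic_nat (k : nat) c : loop_vars v (c + n%:Z * k%:Z) = loop_vars v c.
  elim: k c => [|k IHk] c; first by rewrite mulr0 addr0.
  by rewrite -addn1 PoszD mulrDr mulr1 addrA loop_vars_periodic IHk.
case: d => k c; first exact: periodic_nat.
by rewrite -(periodic_nat k.+1) NegzE mulrN subrK.
Qed.

Lemma loop_mx_below a b : b + m%:Z < a -> loop_mx a b = 0.
Proof. exact: loop_elem_lt. Qed.

Lemma loop_mx_above a b : a < b -> loop_mx a b = 0.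
Proof. by move=> lt_ab; apply: loop_elem_gt; rewrite ltrD2r. Qed.

Lemma loop_mx_one a b : a = b + m%:Z -> loop_mx a b = 1.
Proof. by move=> ->; apply: loop_elem_diag. Qed.

End LoopMatrix.

(** * Blocks of n indices, and minors invariant under unitriangular factors *)

Section Unfolding.

Variables (F : fieldType) (n' : nat).
Local Notation n := n'.+1.

(** Residues start at 0 while indices start at 1, so block 0 consists of the indices 1, ..., n. *)
Definition block (a : int) : int := ((a - 1) %/ n%:Z)%Z.
Definition residue (a : int) : 'I_n := inord `|((a - 1) %% n%:Z)%Z|.

Lemma residueE a : (residue a : nat)%:Z = ((a - 1) %% n%:Z)%Z.
Proof.
have ge0 := modz_ge0 (a - 1) (isT : n%:Z != 0).
have lt_n := ltz_pmod (a - 1) (isT : 0 < n%:Z).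
by rewrite inordK; lia.
Qed.

Lemma block_residue a : a = (residue a)%:Z + 1 + n%:Z * block a.
Proof. by rewrite residueE /block; have := divz_eq (a - 1) n%:Z; lia. Qed.

Lemma block_eq (i : 'I_n) (d : int) : block (i%:Z + 1 + n%:Z * d) = d.
Proof.
rewrite /block addrAC addrK addrC [n%:Z * d]mulrC divzMDl // divz_small ?addr0 //.
by have := ltn_ord i; lia.
Qed.

Lemma residue_eq (i : 'I_n) (d : int) : residue (i%:Z + 1 + n%:Z * d) = i.
Proof.
have := block_residue (i%:Z + 1 + n%:Z * d); rewrite block_eq => E.
by apply/val_inj => /=; lia.
Qed.


Definition unfolded (A : int -> 'M[F]_n) (a b : int) : F :=
  A (block a - block b) (residue a) (residue b).

Definition folded (f : int -> int -> F) (d : int) : 'M[F]_n :=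
  \matrix_(i, j) f (i%:Z + 1 + n%:Z * d) (j%:Z + 1).

Lemma unfolded_folded f :
  (forall d a b, f (a + n%:Z * d) (b + n%:Z * d) = f a b) ->
  forall a b, unfolded (folded f) a b = f a b.
Proof.
move=> per a b; rewrite /unfolded mxE -(per (block b)) -addrA -mulrDr subrK.
by rewrite -!block_residue.
Qed.

Definition uunitri (u : 'M[F]_n) : Prop :=
  (forall i j : 'I_n, (j < i)%N -> u i j = 0) /\ (forall i, u i i = 1).

Lemma uunitri1 : uunitri 1%:M.
Proof.
split=> [i j lt_ji|i]; rewrite mxE ?eqxx //.
by case: eqP lt_ji => // ->; rewrite ltnn.
Qed.

Lemma uunitri_mul u v : uunitri u -> uunitri v -> uunitri (u *m v).
Proof.
move=> [u0 u1] [v0 v1]; split=> [i j lt_ji|i]; rewrite mxE.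
  apply: big1 => k _; case: (ltnP k i) => [/u0->|le_ik]; first by rewrite mul0r.
  by rewrite v0 ?mulr0 //; apply: leq_trans le_ik.
rewrite (bigD1 i) //= u1 v1 mulr1 big1 ?addr0 // => k ne_ki.
case: (ltngtP k i) => [/u0->|/v0->|/val_inj eq_ki]; rewrite ?mul0r ?mulr0 //.
by rewrite eq_ki eqxx in ne_ki.
Qed.

(* An upper unitriangular matrix acting on the left adds to a row only later   *)
(* rows of the same block, and one acting on the right adds to a column only   *)
(* earlier columns of the same block.                                          *)
Definition row_closed (l : nat) (a : 'I_l -> int) : Prop :=
  forall c, (residue (a c) < n')%N -> exists c', a c' = a c + 1.

Definition col_closed (l : nat) (b : 'I_l -> int) : Prop :=
  forall c, (0 < residue (b c))%N -> exists c', b c' = b c - 1.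

Lemma row_closed_block (l : nat) (a : 'I_l -> int) (c : 'I_l) (i : 'I_n) :
  row_closed a -> (residue (a c) <= i)%N ->
  exists c', block (a c') = block (a c) /\ residue (a c') = i.
Proof.
move=> a_closed le_i.
suff [c' a_c'] : exists c', a c' = i%:Z + 1 + n%:Z * block (a c).
  by exists c'; rewrite a_c' block_eq residue_eq.
case: i le_i => i lt_in /=; elim: i lt_in => [|i IHi] lt_in le_i.
  by exists c; rewrite {1}[a c]block_residue; lia.
case: (leqP (residue (a c)) i) => [le_i'|gt_i]; last first.
  by exists c; rewrite {1}[a c]block_residue; lia.
have [c' a_c'] := IHi (ltnW lt_in) le_i'.
have [|c'' a_c''] := a_closed c'.
  by rewrite a_c' (residue_eq (Ordinal (ltnW lt_in))).
by exists c''; rewrite a_c'' a_c'; lia.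
Qed.

Lemma col_closed_block (l : nat) (b : 'I_l -> int) (c : 'I_l) (i : 'I_n) :
  col_closed b -> (i <= residue (b c))%N ->
  exists c', block (b c') = block (b c) /\ residue (b c') = i.
Proof.
move=> b_closed le_i.
suff [c' b_c'] : exists c', b c' = i%:Z + 1 + n%:Z * block (b c).
  by exists c'; rewrite b_c' block_eq residue_eq.
have [k def_k] : exists k, (i + k = residue (b c))%N.
  by exists (residue (b c) - i)%N; rewrite subnKC.
elim: k i {le_i} def_k => [|k IHk] i def_k.
  by exists c; rewrite {1}[b c]block_residue -def_k addn0.
have lt_i : (i.+1 < n)%N by have := ltn_ord (residue (b c)); lia.
have [|c' b_c'] := IHk (Ordinal lt_i); first by rewrite /=; lia.
have [|c'' b_c''] := b_closed c'; first by rewrite b_c' residue_eq.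
by exists c''; rewrite b_c'' b_c' /=; lia.
Qed.

(** Turns multiplication by u or v within a block into multiplication by an l x l matrix: the
    support of the sum is met by the index family, and injectivity excludes repetitions. *)
Lemma sum_residue (l : nat) (a : 'I_l -> int) (q : int) (G : 'I_n -> F) :
  injective a ->
  (forall i, G i != 0 -> exists c, block (a c) = q /\ residue (a c) = i) ->
  \sum_i G i = \sum_(c | block (a c) == q) G (residue (a c)).
Proof.
move=> a_inj G_supp; rewrite [RHS](partition_big (residue \o a) predT) //=.
apply: eq_bigr => i _; have [Gi0|/G_supp[c [q_c i_c]]] := eqVneq (G i) 0.
  by rewrite big1 // => c /andP[_ /eqP->].
rewrite (big_pred1 c) ?i_c // => c' /=; apply/andP/eqP => [[/eqP q_c' /eqP i_c']|->].
  by apply: a_inj; rewrite [LHS]block_residue [RHS]block_residue q_c' i_c' q_c i_c.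
by rewrite q_c i_c !eqxx.
Qed.

Lemma decreasing_inj (l : nat) (a : 'I_l -> int) : decreasing a -> injective a.
Proof.
move=> /decreasingP dec c c' eq_a; apply/val_inj.
by case: (ltngtP c c') => // /dec; rewrite eq_a ltxx.
Qed.

(** Closure of the row set makes u act on the minor as a left factor [U]; since the indices
    decrease, [U] is lower triangular with diagonal 1. *)
Lemma det_unfolded_mull (l : nat) (a b : 'I_l -> int) (A : int -> 'M[F]_n) u :
  decreasing a -> row_closed a -> uunitri u ->
  \det (\matrix_(c, c') unfolded (fun d => u *m A d) (a c) (b c'))
  = \det (\matrix_(c, c') unfolded A (a c) (b c')).
Proof.
move=> dec_a a_closed [u0 u1].
pose U := \matrix_(c < l, c' < l)
  if block (a c') == block (a c) then u (residue (a c)) (residue (a c')) else 0.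
have -> : \matrix_(c, c') unfolded (fun d => u *m A d) (a c) (b c')
          = U *m (\matrix_(c, c') unfolded A (a c) (b c')).
  apply/matrixP => c c'; rewrite !mxE /unfolded mxE (@sum_residue _ a (block (a c))).
  - rewrite big_mkcond; apply: eq_bigr => k _; rewrite !mxE.
    by case: eqP => [<-|]; rewrite ?mul0r.
  - exact: decreasing_inj.
  move=> i nz; apply: row_closed_block => //; rewrite leqNgt; apply/negP => /u0 u_eq0.
  by rewrite u_eq0 mul0r eqxx in nz.
rewrite det_mulmx det_trig ?big1 ?mul1r // => [c _|]; first by rewrite mxE eqxx u1.
apply/is_trig_mxP => c c' lt_cc'; rewrite mxE; case: eqP => // eq_block.
have /decreasingP/(_ _ _ lt_cc') := dec_a.
rewrite {1}[a c']block_residue {1}[a c]block_residue eq_block => lt_a.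
by apply: u0; lia.
Qed.

Lemma det_unfolded_mulr (l : nat) (a b : 'I_l -> int) (A : int -> 'M[F]_n) v :
  decreasing b -> col_closed b -> uunitri v ->
  \det (\matrix_(c, c') unfolded (fun d => A d *m v) (a c) (b c'))
  = \det (\matrix_(c, c') unfolded A (a c) (b c')).
Proof.
move=> dec_b b_closed [v0 v1].
pose V := \matrix_(c < l, c' < l)
  if block (b c) == block (b c') then v (residue (b c)) (residue (b c')) else 0.
have -> : \matrix_(c, c') unfolded (fun d => A d *m v) (a c) (b c')
          = (\matrix_(c, c') unfolded A (a c) (b c')) *m V.
  apply/matrixP => c c'; rewrite !mxE /unfolded mxE (@sum_residue _ b (block (b c'))).
  - rewrite big_mkcond; apply: eq_bigr => k _; rewrite !mxE.
    by case: eqP => [<-|]; rewrite ?mulr0.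
  - exact: decreasing_inj.
  move=> i nz; apply: col_closed_block => //; rewrite leqNgt; apply/negP => /v0 v_eq0.
  by rewrite v_eq0 mulr0 eqxx in nz.
rewrite det_mulmx [\det V]det_trig ?[X in _ * X]big1 ?mulr1 // => [c _|].
  by rewrite mxE eqxx v1.
apply/is_trig_mxP => c c' lt_cc'; rewrite mxE; case: eqP => // eq_block.
have /decreasingP/(_ _ _ lt_cc') := dec_b.
rewrite {1}[b c']block_residue {1}[b c]block_residue eq_block => lt_b.
by apply: v0; lia.
Qed.

Lemma det_unfolded_uunitri (l : nat) (a b : 'I_l -> int) (A : int -> 'M[F]_n) u v :
  decreasing a -> decreasing b -> row_closed a -> col_closed b ->
  uunitri u -> uunitri v ->
  \det (\matrix_(c, c') unfolded (fun d => u *m A d *m v) (a c) (b c'))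
  = \det (\matrix_(c, c') unfolded A (a c) (b c')).
Proof. by move=> *; rewrite det_unfolded_mulr // det_unfolded_mull. Qed.

Definition uequiv (A B : 'M[F]_n) : Prop :=
  exists u v, [/\ uunitri u, uunitri v & u *m A *m v = B].

Lemma uequiv_refl A : uequiv A A.
Proof. by exists 1%:M, 1%:M; split; rewrite ?mul1mx ?mulmx1 //; apply: uunitri1. Qed.

Lemma uequiv_trans A B C : uequiv A B -> uequiv B C -> uequiv A C.
Proof.
move=> [u [v [u_uni v_uni <-]]] [u' [v' [u'_uni v'_uni <-]]].
by exists (u' *m u), (v *m v'); rewrite !mulmxA; split=> //; apply: uunitri_mul.
Qed.

(** Multiples of row p clear column q, then multiples of column q clear row p. The zeros below and
    to the left of the pivot mean that only earlier rows and later columns change, so both factors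
    are upper unitriangular. *)
Lemma pivot_step (B : 'M[F]_n) (p q : 'I_n) :
  B p q != 0 -> (forall i : 'I_n, (p < i)%N -> B i q = 0) ->
  (forall j : 'I_n, (j < q)%N -> B p j = 0) ->
  uequiv B (\matrix_(i, j)
    if (i == p) || (j == q) then (if (i == p) && (j == q) then B p q else 0)
    else B i j - B i q * B p j / B p q).
Proof.
move=> nz_pq B_col B_row.
pose c : 'cV[F]_n := \col_i if i == p then 0 else B i q / B p q.
pose w : 'rV[F]_n := \row_j if j == q then 0 else B p j / B p q.
exists (1%:M - c *m delta_mx 0 p), (1%:M - delta_mx q 0 *m w); split.
- split=> [i j lt_ji|i]; rewrite !mxE big_ord1 !mxE /=.
    case: (eqVneq i j) lt_ji => [->|_ lt_ji]; first by rewrite ltnn.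
    case: (eqVneq j p) => [def_j|_]; last by rewrite mulr0 subr0.
    case: ifP => _; first by rewrite mul0r subr0.
    by rewrite B_col ?mul0r ?subr0 // -def_j.
  by rewrite eqxx; case: eqP; rewrite ?mulr0 ?mul0r subr0.
- split=> [i j lt_ji|i]; rewrite !mxE big_ord1 !mxE /=.
    case: (eqVneq i j) lt_ji => [->|_ lt_ji]; first by rewrite ltnn.
    case: (eqVneq i q) => [def_i|_]; last by rewrite mul0r subr0.
    case: ifP => _; first by rewrite mulr0 subr0.
    by rewrite B_row ?mul0r ?mulr0 ?subr0 // -def_i.
  by rewrite eqxx; case: eqP; rewrite ?mulr0 ?mul0r subr0.
have delta_row : delta_mx 0 p *m B = row p B by rewrite -rowE.
have delta_col : B *m delta_mx q 0 = col q B by rewrite -colE.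
rewrite mulmxBl mul1mx mulmxBr mulmx1 mulmxBl -!mulmxA delta_row.
rewrite !mulmxA delta_col -!mulmxA (mulmxA (delta_mx 0 p)) delta_row.
have -> : row p B *m (delta_mx q 0 *m w) = B p q *: w.
  rewrite mulmxA -colE (_ : col q _ = (B p q)%:M) ?mul_scalar_mx //.
  by apply/matrixP => i j; rewrite !mxE !ord1 eqxx.
apply/matrixP => i j; rewrite !mxE !big_ord1 !mxE.
by have [->|_] := eqVneq i p; have [->|_] := eqVneq j q => /=; field.
Qed.

End Unfolding.

(** * Reduction of the loop matrix *)

Lemma unfolded_shift (F : fieldType) (n' : nat) (A : int -> 'M[F]_n'.+1) (e a b : int) :
  unfolded A (a + n'.+1%:Z * e) (b + n'.+1%:Z * e) = unfolded A a b.
Proof.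
have shift c : block n' (c + n'.+1%:Z * e) = block n' c + e
    /\ residue n' (c + n'.+1%:Z * e) = residue n' c.
  by rewrite {1 3}[c](block_residue n') -addrA -mulrDr block_eq residue_eq.
rewrite /unfolded; have [-> ->] := shift a; have [-> ->] := shift b.
by congr (A _ _ _); ring.
Qed.

Lemma col_len_nseq (k w c : nat) : col_len (nseq k w) c = if (c <= w)%N then k else 0%N.
Proof. by rewrite /col_len count_nseq; case: leqP; rewrite ?mul1n ?mul0n. Qed.

Lemma sorted_nseq (k w : nat) : sorted geq (nseq k w).
Proof. by case: k => //= k; elim: k => //= k ->; rewrite /geq /= leqnn. Qed.

Lemma col_len_cat (la mu : seq nat) (c : nat) :
  col_len (la ++ mu) c = (col_len la c + col_len mu c)%N.
Proof. exact: count_cat. Qed.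

Lemma sorted_nseq_cat (k w k' w' : nat) :
  (w' <= w)%N -> sorted geq (nseq k w ++ nseq k' w').
Proof.
move=> le_w; elim: k => [|k IHk] /=; first exact: sorted_nseq.
rewrite path_sortedE ?IHk; last by move=> y z t; rewrite /geq /=; lia.
by rewrite all_cat !all_nseq /= leqnn le_w !orbT.
Qed.

Section UnipotentReduction.

Variables (F : fieldType) (m n' : nat).
Local Notation n := n'.+1.
Variable x : 'M[F]_(m, n).
Hypothesis shape_inv_neq0 : forall k, (0 < k <= minn m n)%N -> shape_inv x k != 0.

Local Notation L := (loop_mx x).
Local Notation E := (folded n' L).
Local Notation S := (shape_inv x).

Let M0 : 'M[F]_n := \matrix_(i, j) Mprime x i.+1 j.+1.

Lemma unfold_loop a b : unfolded E a b = L a b.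
Proof. by apply: unfolded_folded => d a' b'; apply: loop_mx_periodic. Qed.

Lemma shape_inv_unit k : (0 < k)%N -> S k != 0.
Proof.
move=> k_gt0; case: (leqP k (minn m n)) => [le_k|lt_k].
  by apply: shape_inv_neq0; rewrite k_gt0.
by rewrite /shape_inv leqNgt lt_k oner_eq0.
Qed.

(** For k <= min(m, n) this is dual Jacobi-Trudi for the rectangle. Otherwise either k = n + 1 and
    the determinant is empty, or k = m + 1 <= n and the matrix is triangular with diagonal 1. *)
Lemma shape_inv_det (N k : nat) :
  (0 < k)%N -> (k <= m.+1)%N -> (N + k = n.+1)%N ->
  \det (\matrix_(c < N, c' < N) L (n%:Z - c%:Z) (N%:Z - c'%:Z)) = S k.
Proof.
move=> k_gt0 le_km def_N; rewrite /shape_inv; case: leqP => [le_k|lt_k].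
  rewrite (@loop_schur_det _ _ _ _ N) ?sorted_nseq //; last 2 first.
  - by move=> a; rewrite /part nth_nil.
  - by rewrite /part nth_nseq; case: ifP; lia.
  congr (\det _); apply/matrixP => c c'; rewrite !mxE col_len_nseq.
  have lt_c' := ltn_ord c'; rewrite ifT; last by lia.
  by congr (loop_mx x _ _); rewrite /=; lia.
case: (leqP k n) => [le_kn|lt_nk]; last first.
  by case: N def_N => [|N] def_N; [rewrite det_mx00 | lia].
rewrite det_trig => [|]; last first.
  by apply/is_trig_mxP => c c' lt_cc'; rewrite mxE loop_mx_below //; lia.
by rewrite big1 // => c _; rewrite mxE loop_mx_one //; lia.
Qed.

(** * Minors and support of the blocks u A_d v *)

Section Conjugate.

Variables u v : 'M[F]_n.
Hypotheses (u_uni : uunitri u) (v_uni : uunitri v).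

Local Notation B := (fun d => u *m E d *m v).

(** The last N rows and the first N columns of block 0 are closed index sets. *)
Lemma shape_inv_det_conj (N k : nat) :
  (0 < k)%N -> (k <= m.+1)%N -> (N + k = n.+1)%N ->
  \det (\matrix_(c < N, c' < N) unfolded B (n%:Z - c%:Z) (N%:Z - c'%:Z)) = S k.
Proof.
move=> k_gt0 le_km def_N; rewrite det_unfolded_uunitri //.
- rewrite -(shape_inv_det k_gt0 le_km def_N); congr (\det _).
  by apply/matrixP => c c'; rewrite !mxE unfold_loop.
- by apply/decreasingP => c c'; lia.
- by apply/decreasingP => c c'; lia.
- move=> c; case: (posnP c) => [->|c_gt0].
    have -> : n%:Z - 0%:Z = (ord_max : 'I_n)%:Z + 1 + n%:Z * 0 by rewrite /=; lia.
    by rewrite residue_eq /= ltnn.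
  have lt_c : (c.-1 < N)%N by have := ltn_ord c; lia.
  by exists (Ordinal lt_c) => /=; lia.
move=> c; case: (ltnP c.+1 N) => [lt_c|le_N].
  by exists (Ordinal lt_c) => /=; lia.
have -> : N%:Z - c%:Z = (ord0 : 'I_n)%:Z + 1 + n%:Z * 0.
  by rewrite /=; have := ltn_ord c; lia.
by rewrite residue_eq.
Qed.

Lemma unfold_conj0 (i j : 'I_n) (e : int) :
  unfolded B (i%:Z + 1 + n%:Z * e) (j%:Z + 1 + n%:Z * e) = B 0 i j.
Proof. by rewrite /unfolded !block_eq !residue_eq subrr. Qed.

Lemma conj_neg (d : int) : d < 0 -> B d = 0.
Proof.
move=> d_lt0; suff -> : E d = 0 by rewrite mulmx0 mul0mx.
apply/matrixP => i j; rewrite !mxE loop_mx_above //.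
have := ltn_ord i; nia.
Qed.

(** Multiplication by u brings in only later rows and by v only earlier columns, both still further
    below the band of [loop_mx]. *)
Lemma conj_below (d : int) (i j : 'I_n) :
  j%:Z + m%:Z < i%:Z + n%:Z * d -> B d i j = 0.
Proof.
case: u_uni v_uni => [u0 _] [v0 _] lt_ji; rewrite mxE big1 // => k _; rewrite mxE.
rewrite big_distrl big1 // => k' _ /=; rewrite mxE.
case: (ltnP k' i) => [/u0->|le_ik']; first by rewrite !mul0r.
case: (ltnP j k) => [/v0->|le_kj]; first by rewrite mulr0.
by rewrite loop_mx_below ?mulr0 ?mul0r //; lia.
Qed.

Lemma conj_one (d : int) (i j : 'I_n) :
  j%:Z + m%:Z = i%:Z + n%:Z * d -> B d i j = 1.
Proof.
case: u_uni v_uni => [u0 u1] [v0 v1] eq_ji; rewrite mxE (bigD1 j) //= v1 mulr1.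
rewrite mxE (bigD1 i) //= u1 mul1r mxE loop_mx_one; last by lia.
rewrite !big1 ?addr0 // => k ne_k.
  rewrite mxE; case: (ltngtP j k) => [/v0->|lt_kj|/val_inj eq_k]; rewrite ?mulr0 //.
    rewrite big1 ?mul0r // => k' _; rewrite mxE.
    case: (ltnP k' i) => [/u0->|le_ik']; first by rewrite !mul0r.
    by rewrite loop_mx_below ?mulr0 //; lia.
  by rewrite eq_k eqxx in ne_k.
case: (ltngtP k i) => [/u0->|lt_ik|/val_inj eq_k]; rewrite ?mul0r //.
  by rewrite mxE loop_mx_below ?mulr0 //; lia.
by rewrite eq_k eqxx in ne_k.
Qed.

End Conjugate.

(** Produces the entries of M' with i - j = m, present only when m < n. The ones on the edge of the
    band serve as pivots from left to right: entries below them vanish, and the columns to their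
    left are already cleared. *)
Lemma unipotent_band (q : nat) : (q + m <= n)%N ->
  exists2 B, uequiv (E 0) B &
    forall i j : 'I_n, (j + m <= i)%N || (j < q)%N || (m <= i < q + m)%N ->
      B i j = (i == (j + m)%N :> nat)%:R.
Proof.
elim: q => [|q IHq] le_q.
  exists (E 0) => [|i j ij]; first exact: uequiv_refl.
  rewrite mxE; case: eqP => [eq_ij|ne_ij]; first by rewrite loop_mx_one //; lia.
  by rewrite loop_mx_below //; lia.
have [B equiv_B B_eq] := IHq (ltnW le_q).
have lt_q : (q < n)%N by lia.
have [p0 p0E] : exists p0 : 'I_n, p0 = (q + m)%N :> nat by exists (Ordinal le_q).
have [q0 q0E] : exists q0 : 'I_n, q0 = q :> nat by exists (Ordinal lt_q).
have B_pq : B p0 q0 = 1 by rewrite B_eq ?p0E ?q0E ?eqxx //; lia.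
have B_col (i : 'I_n) : (p0 < i)%N -> B i q0 = 0.
  by move=> lt_i; rewrite B_eq; first case: eqP => //; lia.
have B_row (j : 'I_n) : (j < q0)%N -> B p0 j = 0.
  by move=> lt_j; rewrite B_eq; first case: eqP => //; lia.
have := pivot_step _ B_col B_row; rewrite B_pq oner_eq0 => /(_ isT) equiv_B'.
apply: ex_intro2 (uequiv_trans equiv_B equiv_B') _ => i j ij; rewrite mxE.
have [->|/eqP ne_i] := eqVneq i p0; have [->|/eqP ne_j] := eqVneq j q0 => /=.
- by rewrite p0E q0E eqxx.
- by case: eqP => // eq_j; case: ne_j; apply/val_inj => /=; lia.
- by case: eqP => // eq_i; case: ne_i; apply/val_inj => /=; lia.
have ne_i' : (i <> q + m :> nat)%N by rewrite -p0E => /val_inj/ne_i.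
have ne_j' : (j <> q :> nat)%N by rewrite -q0E => /val_inj/ne_j.
rewrite B_eq; last by lia.
case: (ltnP j q) => [lt_jq|le_qj]; first by rewrite B_row ?q0E // mulr0 mul0r subr0.
case: (ltnP (q + m) i) => [lt_i|le_i]; first by rewrite B_col ?p0E // !mul0r subr0.
rewrite (B_eq i q0) ?q0E; last by lia.
by case: (i =P (q + m)%N :> nat) => // _; rewrite !mul0r subr0.
Qed.

Lemma Mprime0 (i j : 'I_n) :
  M0 i j = if (i < m)%N && (i + j == n')%N
           then (-1) ^+ (n' - i) * (S i.+1 / S i.+2)
           else (i == (j + m)%N :> nat)%:R.
Proof.
rewrite mxE /Mprime !addn1 subSS.
have -> : (i.+1 + j.+1 == n.+1)%N = (i + j == n')%N by lia.
have -> : (i.+1 == j.+1 + m)%N = (i == (j + m)%N :> nat) by lia.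
by case: ifP => // _; case: eqP.
Qed.

(** Descending induction on p: the pivots (p, n' - p) go up the antidiagonal. It starts at p =
    min(m, n), where the condition is void if n <= m and [unipotent_band] applies otherwise. *)
Lemma unipotent_antidiag (p : nat) : (p <= minn m n)%N ->
  exists2 B, uequiv (E 0) B &
    forall i j : 'I_n, (p <= i)%N || (j < n - p)%N -> B i j = M0 i j.
Proof.
move=> le_p; have [k def_k] : exists k, (p + k = minn m n)%N.
  by exists (minn m n - p)%N; rewrite subnKC.
elim: k p def_k {le_p} => [|k IHk] p def_k.
  case: (leqP n m) => [le_nm|lt_mn].
    exists (E 0) => [|i j]; first exact: uequiv_refl.
    by have := ltn_ord i; lia.
  have [|B equiv_B B_eq] := @unipotent_band (n - m)%N; first by lia.
  exists B => // i j ij; rewrite B_eq ?Mprime0; last by have := ltn_ord i; lia.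
  by rewrite ifF //; have := ltn_ord i; lia.
have [|B equiv_B B_eq] := IHk p.+1; first by lia.
have lt_pn : (p < n)%N by lia.
have lt_qn : (n' - p < n)%N by lia.
have [p0 p0E] : exists p0 : 'I_n, p0 = p :> nat by exists (Ordinal lt_pn).
have [q0 q0E] : exists q0 : 'I_n, q0 = (n' - p)%N :> nat by exists (Ordinal lt_qn).
have M0_row (j : 'I_n) : j <> q0 -> M0 p0 j = 0.
  move=> ne_j; have {}ne_j : (j <> n' - p :> nat)%N by rewrite -q0E => /val_inj/ne_j.
  by rewrite Mprime0 ifF; [case: eqP => // | ]; lia.
have M0_col (i : 'I_n) : i <> p0 -> M0 i q0 = 0.
  move=> ne_i; have {}ne_i : (i <> p :> nat)%N by rewrite -p0E => /val_inj/ne_i.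
  by have := ltn_ord i; rewrite Mprime0 ifF; [case: eqP => // | ]; lia.
have M0_pq : M0 p0 q0 = (-1) ^+ (n' - p) * (S p.+1 / S p.+2).
  by rewrite Mprime0 p0E q0E ifT //; lia.
have B_row (j : 'I_n) : (j < q0)%N -> B p0 j = 0.
  move=> lt_j; rewrite B_eq ?M0_row //; last by lia.
  by move=> eq_j; rewrite eq_j ltnn in lt_j.
have B_col (i : 'I_n) : (p0 < i)%N -> B i q0 = 0.
  move=> lt_i; rewrite B_eq ?M0_col //; last by lia.
  by move=> eq_i; rewrite eq_i ltnn in lt_i.
have B_pq : B p0 q0 = M0 p0 q0.
  have [u [v [u_uni v_uni def_B]]] := equiv_B.
  pose C d := u *m E d *m v.
  have C_eq (i j : 'I_n) a b : a = i%:Z + 1 -> b = j%:Z + 1 -> unfolded C a b = B i j.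
    by move=> -> ->; rewrite -def_B -(unfold_conj0 u v i j 0) mulr0 !addr0.
  have le1 : (p.+1 <= m.+1)%N by lia.
  have le2 : (p.+2 <= m.+1)%N by lia.
  have eq1 : ((n' - p).+1 + p.+1 = n.+1)%N by lia.
  have eq2 : ((n' - p) + p.+2 = n.+1)%N by lia.
  (* Indices are listed in decreasing order, so row p comes last and only its first entry, the
     pivot, is nonzero. Expanding along it gives S_(p+1) as the pivot times S_(p+2), with the sign
     (-1)^(n' - p). *)
  have := shape_inv_det_conj u_uni v_uni (ltn0Sn _) le1 eq1.
  rewrite -/C (expand_det_row _ ord_max) big_ord_recl big1 ?addr0 => [|j _]; last first.
    rewrite mxE; have lt_j : (n' - p - j.+1 < n)%N by lia.
    rewrite (C_eq p0 (Ordinal lt_j)) ?B_row ?mul0r //=;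
      have := ltn_ord j; rewrite ?p0E ?q0E /bump /=; lia.
  rewrite mxE (C_eq p0 q0) /=; last 2 first.
  - by rewrite p0E; lia.
  - by rewrite q0E; lia.
  rewrite /cofactor /= addn0 => det_p.
  have def_det : \det (row' ord_max (col' ord0
      (\matrix_(c < (n' - p).+1, c' < (n' - p).+1)
         unfolded C (n%:Z - c%:Z) ((n' - p).+1%:Z - c'%:Z)))) = S p.+2.
    rewrite -(shape_inv_det_conj u_uni v_uni (ltn0Sn _) le2 eq2); congr (\det _).
    apply/matrixP => c c'; rewrite !mxE lift_max lift0.
    by congr (unfolded _ _ _); lia.
  rewrite M0_pq -det_p def_det.
  have sgn2 : (-1) ^+ (n' - p) * (-1) ^+ (n' - p) = 1 :> F by rewrite -expr2 sqrr_sign.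
  transitivity (B p0 q0 * ((-1) ^+ (n' - p) * (-1) ^+ (n' - p))).
    by rewrite sgn2 mulr1.
  by move: ((-1) ^+ _) => sg; field; rewrite shape_inv_unit.
have := pivot_step _ B_col B_row; rewrite B_pq => equiv_B'.
apply: ex_intro2 (uequiv_trans equiv_B (equiv_B' _)) _ => [|i j ij].
  by rewrite M0_pq !mulf_neq0 ?invr_neq0 ?signr_eq0 ?shape_inv_unit.
rewrite mxE; have [->|/eqP ne_i] := eqVneq i p0; have [->|/eqP ne_j] := eqVneq j q0.
- by [].
- by rewrite (M0_row j).
- by rewrite (M0_col i).
have ne_i' : (i <> p :> nat)%N by rewrite -p0E => /val_inj/ne_i.
have ne_j' : (j <> n' - p :> nat)%N by rewrite -q0E => /val_inj/ne_j.
rewrite /= B_eq; last by lia.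
case: (ltnP p i) => [lt_i|le_i]; first by rewrite B_col ?p0E // !mul0r subr0.
by rewrite B_row ?q0E ?mulr0 ?mul0r ?subr0 //; lia.
Qed.

(** * The blocks u A_d v are the coefficients of [Mhat] *)

Section Entries.

Variables u v : 'M[F]_n.
Hypotheses (u_uni : uunitri u) (v_uni : uunitri v) (def_M0 : u *m E 0 *m v = M0).

Local Notation C := (fun d => u *m E d *m v).

(* The dual Jacobi-Trudi minor of this shape has the row indices i + 1, ..., n *)
(* of block [d] and the last [j] ones of block -1, and the column indices      *)
(* 1, ..., n - i - 1 of block [d] and 1, ..., j + 1 of block -1.  It is block  *)
(* triangular, the middle block being the single entry [C d.+1 i j].           *)
Lemma conj_loop_schur (d k : nat) (i j : 'I_n) :
  (0 < k)%N -> (k + i + n * d.+1 = m + j)%N ->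
  S i.+2 * (C d.+1 i j * S (n.+1 - j))
  = loop_schur x (n%:Z - i%:Z)
      (nseq (m + j - n) (n' - i + j.+1)%N ++ nseq (n * d.+1 - j.+1) (n' - i)%N)
      (nseq (m + j - n - k) (n - i)%N).
Proof.
move=> k_gt0 def_k.
have lt_in := ltn_ord i; have lt_jn := ltn_ord j.
have le_n : (n <= n * d.+1)%N by rewrite leq_pmulr.
have le_nd : (n%:Z <= n%:Z * d.+1%:Z) by rewrite -PoszM lez_nat.
have def_nd : n%:Z * d.+1%:Z = n%:Z + n%:Z * d%:Z by rewrite -addn1 PoszD; ring.
pose l := ((n' - i) + (1 + j))%N.
have lE : l = (n' - i + (1 + j))%N by [].
pose a (c : 'I_l) : int :=
  (if (c <= n' - i)%N then n%:Z * d.+1%:Z else n%:Z - i%:Z) - c%:Z.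
pose b (c : 'I_l) : int :=
  (if (c < n' - i)%N then n%:Z * d.+1%:Z - 1 - i%:Z else j%:Z - i%:Z) - c%:Z.
have dec_a : decreasing a.
  apply/decreasingP => c c' lt_cc'; rewrite /a.
  by case: (leqP c' _) => ?; case: (leqP c _) => ?; lia.
have dec_b : decreasing b.
  apply/decreasingP => c c' lt_cc'; rewrite /b.
  by case: (ltnP c' _) => ?; case: (ltnP c _) => ?; lia.
have a_closed : row_closed n' a.
  move=> c; have lt_c := ltn_ord c.
  case: (posnP c) => [c0|c_gt0].
    have -> : a c = (ord_max : 'I_n)%:Z + 1 + n%:Z * d%:Z.
      by rewrite /a c0 /=; lia.
    by rewrite residue_eq /= ltnn.
  case: (eqVneq (c : nat) (n' - i).+1) => [c1|/eqP c1].
    have -> : a c = (ord_max : 'I_n)%:Z + 1 + n%:Z * -1.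
      by rewrite /a c1 ltnn /=; lia.
    by rewrite residue_eq /= ltnn.
  have lt_c1 : (c.-1 < l)%N by lia.
  exists (Ordinal lt_c1); rewrite /a /=.
  by case: (leqP c.-1 _) => ?; case: (leqP c _) => ?; lia.
have b_closed : col_closed n' b.
  move=> c; have lt_c := ltn_ord c.
  case: (eqVneq (c.+1) (n' - i)%N) => [c1|/eqP c1].
    have -> : b c = (ord0 : 'I_n)%:Z + 1 + n%:Z * d%:Z.
      by rewrite /b ifT /=; lia.
    by rewrite residue_eq.
  case: (ltnP c.+1 l) => [lt_c1|le_c1]; last first.
    have -> : b c = (ord0 : 'I_n)%:Z + 1 + n%:Z * -1.
      have def_c : c = (n' - i + j)%N :> nat by lia.
      by rewrite /b def_c ltnNge leq_addr /=; lia.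
    by rewrite residue_eq.
  exists (Ordinal lt_c1); rewrite /b /=.
  by case: (ltnP c.+1 _) => ?; case: (ltnP c _) => ?; lia.
transitivity (\det (\matrix_(c, c') unfolded C (a c) (b c'))); last first.
  rewrite det_unfolded_uunitri // (@loop_schur_det _ _ _ _ l) ?sorted_nseq ?sorted_nseq_cat //.
  - congr (\det _); apply/matrixP => c c'; rewrite !mxE unfold_loop.
    rewrite col_len_cat !col_len_nseq; have lt_c' := ltn_ord c'.
    have -> : (c'.+1 <= n' - i + j.+1)%N by lia.
    have eq_c : (c.+1 <= n - i)%N = (c <= n' - i)%N by lia.
    by congr (loop_mx x _ _); rewrite /a /b ?eq_c; case: ifP => ?; lia.
  - by rewrite leq_addr.
  - by move=> c; rewrite /part nth_cat size_nseq !nth_nseq; do ![case: ifP => ?]; lia.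
  - by rewrite /part nth_cat size_nseq !nth_nseq; do ![case: ifP => ?]; lia.
set M := \matrix_(c, c') _.
have MU c c' : M c c' = unfolded C (a c) (b c') by rewrite mxE.
have ME c c' (p q : 'I_n) e e' : a c = p%:Z + 1 + n%:Z * e ->
    b c' = q%:Z + 1 + n%:Z * e' -> M c c' = C (e - e') p q.
  by move=> a_c b_c'; rewrite MU a_c b_c' /unfolded !block_eq !residue_eq.
clearbody M.
(* Row i of block d meets these columns strictly left of the antidiagonal of M', where M' vanishes
   because i < m; the rows of block -1 meet them in negative degree. *)
have dl0 : dlsubmx M = 0.
  apply/matrixP => c c'; rewrite !mxE; have lt_c' := ltn_ord c'.
  have lt_q : (n' - i - c'.+1 < n)%N by lia.
  case: (split_ordP c) => c0 ->.
    rewrite ord1 (ME _ _ i (Ordinal lt_q) d%:Z d%:Z) /a /b /=; last 2 first.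
    - by rewrite addn0 leqnn; lia.
    - by rewrite lt_c'; lia.
    by rewrite subrr def_M0 Mprime0 ifF /=; [case: eqP => // | ]; lia.
  have lt_c0 := ltn_ord c0; have lt_p : (n' - c0 < n)%N by lia.
  rewrite (ME _ _ (Ordinal lt_p) (Ordinal lt_q) (-1) d%:Z) /a /b /=; last 2 first.
  - by rewrite ifF; lia.
  - by rewrite lt_c'; lia.
  by rewrite conj_neg ?mxE //; lia.
(* These entries of M' lie strictly below the antidiagonal, and [def_k] gives n < m + j, which keeps
   them off the line of ones. *)
have dr_dl0 : dlsubmx (drsubmx M) = 0.
  apply/matrixP => c0 c'; rewrite !mxE ord1.
  have lt_c0 := ltn_ord c0; have lt_p : (n' - c0 < n)%N by lia.
  rewrite (ME _ _ (Ordinal lt_p) j (-1) (-1)) /a /b /=; last 2 first.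
  - by rewrite ifF; lia.
  - by rewrite ifF; lia.
  by rewrite subrr def_M0 Mprime0 ifF /=; [case: eqP => // | ]; lia.
rewrite -[M]submxK dl0 det_ublock -[drsubmx M]submxK dr_dl0 det_ublock det_mx11.
congr (_ * (_ * _)).
- rewrite -(shape_inv_det_conj u_uni v_uni (N := n' - i)) //; try lia.
  congr (\det _); apply/matrixP => c c'; rewrite !mxE MU.
  have lt_c := ltn_ord c; have lt_c' := ltn_ord c'.
  have -> : a (lshift (1 + j) c) = n%:Z - c%:Z + n%:Z * d%:Z.
    by rewrite /a /= (ltnW lt_c); lia.
  have -> : b (lshift (1 + j) c') = (n' - i)%N%:Z - c'%:Z + n%:Z * d%:Z.
    by rewrite /b /= lt_c'; lia.
  by rewrite unfolded_shift.
- rewrite [RHS]mxE [RHS]mxE [RHS]mxE [RHS]mxE (ME _ _ i j d%:Z (-1)) /a /b /=; last 2 first.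
  + by rewrite addn0 leqnn; lia.
  + by rewrite addn0 ltnn; lia.
  by rewrite (_ : d%:Z - -1 = d.+1%:Z) //; lia.
- rewrite -(shape_inv_det_conj u_uni v_uni (N := j)) //; try lia.
  congr (\det _); apply/matrixP => c c'; rewrite !mxE MU.
  have -> : a (rshift (n' - i) (rshift 1 c)) = n%:Z - c%:Z + n%:Z * -1.
    by rewrite /a /= ifF; lia.
  have -> : b (rshift (n' - i) (rshift 1 c')) = j%:Z - c'%:Z + n%:Z * -1.
    by rewrite /b /= ifF; lia.
  by rewrite unfolded_shift.
Qed.

(** The sign of the index of [Qred] locates the entry: 0 is the edge of the band, where it is 1; a
    negative index is below the band; a positive one is covered by [conj_loop_schur]. *)
Lemma Qred_conj (d : nat) (i j : 'I_n) :
  Qred x (m%:Z + j.+1%:Z - i.+1%:Z - n%:Z * d.+1%:Z) i.+1 = C d.+1 i j.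
Proof.
have -> : m%:Z + j.+1%:Z - i.+1%:Z - n%:Z * d.+1%:Z
          = m%:Z + j%:Z - i%:Z - n%:Z * d.+1%:Z by lia.
case def_z : (m%:Z + j%:Z - i%:Z - n%:Z * d.+1%:Z) => [[|k]|k].
- by rewrite conj_one //; lia.
- have lt_in := ltn_ord i; have lt_jn := ltn_ord j.
  have def_k : (k.+1 + i + n * d.+1 = m + j)%N.
    by apply/eqP; rewrite -eqz_nat !PoszD PoszM; lia.
  have le_n : (n <= n * d.+1)%N by rewrite leq_pmulr.
  rewrite /Qred.
  (* Hence the remainder K in [Qred] is the column j, counted from 0. *)
  have -> : (k.+1%:Z + i.+1%:Z - m%:Z - 1 = (- d.+1%:Z) * n%:Z + j%:Z) by lia.
  rewrite modzMDl modz_small ?absz_nat; last by lia.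
  have -> : (n - i.+1 + j + 1 = n' - i + j.+1)%N by lia.
  have -> : (m - k.+1 - i.+1 = n * d.+1 - j.+1)%N by lia.
  have -> : (n - i.+1 + 1 = n - i)%N by lia.
  have -> : n%:Z - i.+1%:Z + 1 = n%:Z - i%:Z by lia.
  rewrite subSS -(conj_loop_schur (k := k.+1)) // !addn1.
  by rewrite [(C _ _ _) * _]mulrC mulrA mulrC mulKf // mulf_neq0 ?shape_inv_unit //; lia.
by rewrite conj_below //; lia.
Qed.

Lemma coef_Mhat (d : nat) (i j : 'I_n) : (Mhat x i.+1 j.+1)`_d = C d i j.
Proof.
have coef_term e : (Qred x (m%:Z + j.+1%:Z - i.+1%:Z - n%:Z * e%:Z) i.+1 *: 'X^e)`_d
    = if e == d then Qred x (m%:Z + j.+1%:Z - i.+1%:Z - n%:Z * d%:Z) i.+1 else 0.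
  by rewrite coefZ coefXn eq_sym; case: eqP => [->|_]; rewrite ?mulr1 ?mulr0.
rewrite /Mhat coefD coefC coef_sum.
under eq_bigr do rewrite coef_term.
rewrite -big_mkcond /=; case: d {coef_term} => [|d].
  rewrite big_nat_cond big_pred0 ?addr0 => [|e]; last by lia.
  by have /matrixP/(_ i j) := def_M0; rewrite !mxE => ->.
rewrite add0r -Qred_conj; case: (ltnP d.+1 (m + n)) => [lt_d|le_d].
  by rewrite (big_nat1_eq _ (fun=> _)) lt_d.
rewrite big_nat_cond big_pred0 => [|e]; last by lia.
(* In degrees d >= m + n, cut off in [Mhat], the entry lies below the band. *)
rewrite Qred_conj conj_below //; have := ltn_ord j; nia.
Qed.

Lemma Mtilde_unfold a b : Mtilde x a b = unfolded C a b.
Proof.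
rewrite /Mtilde /unfold_mx -!residueE !absz_nat /unfolded -/(block n' a) -/(block n' b).
case def_d : (block n' a - block n' b) => [d|d]; first exact: coef_Mhat.
by rewrite conj_neg ?mxE.
Qed.

End Entries.

Lemma det_Mtilde (l : nat) (a b : 'I_l -> int) :
  decreasing a -> decreasing b -> row_closed n' a -> col_closed n' b ->
  \det (\matrix_(c, c') Mtilde x (a c) (b c'))
  = \det (\matrix_(c, c') L (a c) (b c')).
Proof.
move=> dec_a dec_b a_closed b_closed.
(* At p = 0 every column satisfies j < n - p, so the reduced matrix is M' itself. *)
have [B [u [v [u_uni v_uni <-]]] B_eq] := unipotent_antidiag (leq0n _).
have def_M0 : u *m E 0 *m v = M0 by apply/matrixP => i j; apply: B_eq.
transitivity (\det (\matrix_(c, c') unfolded (fun d => u *m E d *m v) (a c) (b c'))).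
  by congr (\det _); apply/matrixP => c c'; rewrite !mxE (Mtilde_unfold u_uni v_uni def_M0).
rewrite det_unfolded_uunitri //; congr (\det _); apply/matrixP => c c'.
by rewrite !mxE unfold_loop.
Qed.

End UnipotentReduction.

(** * Corner colors and minors *)

Lemma residue_mod (n' : nat) (z w : int) :
  (z = w %[mod n'.+1%:Z])%Z -> residue n' z = residue n' w.
Proof.
by move=> eq_zw; apply/val_inj/eqP; rewrite -eqz_nat !residueE -modzDml eq_zw modzDml.
Qed.

Section CornerColors.

Variables (m n' l : nat) (la mu : seq nat) (r : int).
Local Notation n := n'.+1.
Hypotheses (srt_la : sorted geq la) (srt_mu : sorted geq mu).
Hypothesis lE : l = part la 1.
Hypothesis col_gt0 : forall c : 'I_l, (col_len mu c.+1 < col_len la c.+1)%N.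
Hypothesis corners : corner_color_condition m n r la mu.

(** The successor of the index of a column belongs to the column on its left when both have the same
    length in mu. If it is missing, the top cell is a NW corner, and color n is the last residue. *)
Lemma row_closed_corners :
  row_closed n' (fun c : 'I_l => (col_len mu c.+1)%:Z - c%:Z + r).
Proof.
move=> c lt_c.
have [/existsP[c' /eqP]|/existsPn no_next] := boolP [exists c' : 'I_l,
  (col_len mu c'.+1)%:Z - c'%:Z + r == (col_len mu c.+1)%:Z - c%:Z + r + 1].
  by exists c'.
have nw : nw_corner la mu ((col_len mu c.+1).+1, c.+1).
  rewrite /nw_corner /= !mem_skew_cells //= ltnn ltnSn col_gt0 /=.
  case: c {lt_c} no_next => -[//|c] lt_cl no_next /=.
  have := no_next (Ordinal (ltnW lt_cl)); rewrite /= => ne_next.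
  have := col_len_anti mu (leqnSn c.+1); lia.
have := corners.1 _ nw; rewrite /content /=.
have -> : (col_len mu c.+1).+1%:Z - c.+1%:Z + r = (col_len mu c.+1)%:Z - c%:Z + r by lia.
move=> /residue_mod res_c; rewrite res_c in lt_c.
have n_eq : n%:Z = (ord_max : 'I_n)%:Z + 1 + n%:Z * 0 by rewrite /=; lia.
by rewrite n_eq residue_eq /= ltnn in lt_c.
Qed.

(** Dually, a missing predecessor makes the bottom cell a SE corner of color m. The index is that
    color plus 1 - m, hence the first residue. *)
Lemma col_closed_corners :
  col_closed n' (fun c : 'I_l => (col_len la c.+1)%:Z - c%:Z + r - m%:Z).
Proof.
move=> c lt_c.
have [/existsP[c' /eqP]|/existsPn no_prev] := boolP [exists c' : 'I_l,
  (col_len la c'.+1)%:Z - c'%:Z + r - m%:Z == (col_len la c.+1)%:Z - c%:Z + r - m%:Z - 1].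
  by exists c'.
have se : se_corner la mu (col_len la c.+1, c.+1).
  rewrite /se_corner /= !mem_skew_cells //= col_gt0 leqnn ltnn andbF /=.
  apply/negP => /andP[lt_mu le_la].
  have lt_cl : (c.+1 < l)%N.
    have := @leq_part_col_len la 1 c.+2 srt_la isT isT; have := col_gt0 c; lia.
  have := no_prev (Ordinal lt_cl); rewrite /=.
  have := col_len_anti la (leqnSn c.+1); lia.
have := corners.2 _ se; rewrite /content /= => eq_m.
suff res_c : residue n' ((col_len la c.+1)%:Z - c%:Z + r - m%:Z) = ord0.
  by rewrite res_c in lt_c.
have one_eq : 1 = (ord0 : 'I_n)%:Z + 1 + n%:Z * 0 by rewrite /=; lia.
rewrite -[RHS](residue_eq ord0 0) -one_eq; apply: residue_mod.
have -> : (col_len la c.+1)%:Z - c%:Z + r - m%:Z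
          = ((col_len la c.+1)%:Z - c.+1%:Z + r) + (1 - m%:Z) by lia.
by rewrite -modzDml eq_m modzDml addrC subrK.
Qed.

End CornerColors.

(** Sorting reverses both lists; reversing rows and columns together multiplies the determinant by
    the square of a sign. *)
Lemma minor_decreasing (F : fieldType) (A : int -> int -> F) (l : nat)
    (f g : nat -> int) :
  decreasing (fun c : 'I_l => f c.+1) -> decreasing (fun c : 'I_l => g c.+1) ->
  minor A [seq f c | c <- iota 1 l] [seq g c | c <- iota 1 l]
  = \det (\matrix_(c < l, c' < l) A (f c.+1) (g c'.+1)).
Proof.
have sort_dec (h : nat -> int) : decreasing (fun c : 'I_l => h c.+1) ->
    forall c : 'I_l,
    nth 0 (sort <=%R [seq h c | c <- iota 1 l]) c = h (rev_ord c).+1.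
  move=> /decreasingP dec c.
  have -> : sort <=%R [seq h c | c <- iota 1 l] = rev [seq h c | c <- iota 1 l].
    apply: (sorted_eq le_trans le_anti); first exact: sort_le_sorted.
      rewrite rev_sorted; apply/(sortedP 0) => i; rewrite size_map size_iota => lt_i.
      rewrite !(nth_map 0%N) ?size_iota ?nth_iota //; try lia.
      by have := dec (Ordinal (ltnW lt_i)) (Ordinal lt_i) (ltnSn _); move/ltW.
    by rewrite perm_sort perm_sym perm_rev.
  have lt_c := ltn_ord c.
  rewrite nth_rev ?size_map ?size_iota // (nth_map 0%N) ?size_iota ?nth_iota //; lia.
move=> dec_f dec_g; rewrite /minor size_map size_iota.
pose s := perm (@rev_ord_inj l).
transitivity (\det (row_perm s (col_perm s (\matrix_(c < l, c' < l) A (f c.+1) (g c'.+1))))).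
  by congr (\det _); apply/matrixP => c c'; rewrite !mxE !sort_dec // !permE.
rewrite row_permE col_permE !det_mulmx !det_perm odd_permV.
by rewrite mulrCA -expr2 sqrr_sign mulr1.
Qed.

Lemma loop_schur_minor (F : fieldType) (m n' : nat) (x : 'M[F]_(m, n'.+1))
    (la mu : seq nat) (r : int) (l := size (conj_part la)) :
  (forall k, (0 < k <= minn m n'.+1)%N -> shape_inv x k != 0) ->
  is_partition la -> is_partition mu -> part_sub mu la ->
  (forall i : nat, (1 <= i <= l)%N ->
     0 < (part (conj_part la) i)%:Z - (part (conj_part mu) i)%:Z) ->
  corner_color_condition m n'.+1 r la mu ->
  loop_schur x r la mu
  = minor (Mtilde x) (row_set l mu r) (col_set m l la r).
Proof.
move=> S_neq0 /andP[srt_la _] /andP[srt_mu _] sub_mu_la col_gt0 corners.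
have lE : l = part la 1 by rewrite /l size_map size_iota.
have {}col_gt0 (c : 'I_l) : (col_len mu c.+1 < col_len la c.+1)%N.
  have := col_gt0 c.+1; rewrite !part_conj_part // ltn_ord => /(_ isT); lia.
have col_anti (nu : seq nat) (c c' : 'I_l) : (c < c')%N -> (col_len nu c'.+1 <= col_len nu c.+1)%N.
  by move=> lt_cc'; apply: col_len_anti; lia.
rewrite (@loop_schur_det _ _ _ _ l) ?lE // -lE minor_decreasing; last 2 first.
- apply/decreasingP => c c' lt_cc'; have := col_anti mu c c' lt_cc'.
  by rewrite !part_conj_part //; lia.
- apply/decreasingP => c c' lt_cc'; have := col_anti la c c' lt_cc'.
  by rewrite !part_conj_part //; lia.
pose a (c : 'I_l) := (col_len mu c.+1)%:Z - c%:Z + r.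
pose b (c : 'I_l) := (col_len la c.+1)%:Z - c%:Z + r - m%:Z.
rewrite -[LHS](det_Mtilde S_neq0 (a := a) (b := b)).
- congr (\det _); apply/matrixP => c c'; rewrite !mxE !part_conj_part //.
  by congr (Mtilde x _ _); rewrite /a /b; lia.
- by apply/decreasingP => c c' lt_cc'; have := col_anti mu c c' lt_cc'; rewrite /a; lia.
- by apply/decreasingP => c c' lt_cc'; have := col_anti la c c' lt_cc'; rewrite /b; lia.
- exact: row_closed_corners corners.
- exact: col_closed_corners corners.
Qed.

(** * Specialization to indeterminates *)

(* Evaluating all the indeterminates at 1 counts tableaux.                     *)
Lemma loop_schur_indet_neq0 (R : realType) (m n' : nat) (r : int) (la mu : seq nat)
    (T0 : {ffun seq_sub (skew_cells la mu) -> 'I_m}) :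
  is_ssyt T0 -> loop_schur (indet R m n'.+1) r la mu != 0.
Proof.
move=> T0_ssyt.
pose colors (c : nat * nat) (i : 'I_m) :=
  [pred j : 'I_n'.+1 | (j.+1%:Z == content c + r - i.+1%:Z + 1 %[mod n'.+1%:Z])%Z].
pose P : {mpoly R[i][m * n'.+1]} :=
  \sum_(T : {ffun seq_sub (skew_cells la mu) -> 'I_m} | is_ssyt T)
    \prod_s \sum_(j in colors (val s) (T s)) 'X_(mxvec_index (T s) j).
have -> : loop_schur (indet R m n'.+1) r la mu = tofrac P.
  rewrite /P rmorph_sum; apply: eq_bigr => T _.
  rewrite rmorph_prod; apply: eq_bigr => s _; rewrite rmorph_sum.
  by apply: eq_bigr => j _; rewrite mxE.
rewrite tofrac_eq0; apply: contra_neq (_ : P.@[fun=> 1] != 0) => [->|]; first by rewrite meval0.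
have -> : P.@[fun=> 1] = (\sum_(T : {ffun seq_sub (skew_cells la mu) -> 'I_m} | is_ssyt T)
    \prod_s #|colors (val s) (T s)|)%N%:R.
  rewrite /P rmorph_sum natr_sum; apply: eq_bigr => T _.
  rewrite rmorph_prod natr_prod; apply: eq_bigr => s _; rewrite rmorph_sum /=.
  by under eq_bigr do rewrite mevalXU; rewrite sumr_const.
rewrite pnatr_eq0 -lt0n (bigD1 T0) //= addn_gt0 prodn_gt0 // => s.
(* Some column of variables is congruent to [w] mod n, so [T0] alone contributes a positive
   count. *)
apply/card_gt0P; pose w := content (val s) + r - (T0 s).+1%:Z + 1.
exists (residue n' w); rewrite inE -/w {2}(block_residue n' w).
by rewrite [(n'.+1%:Z * _)]mulrC addrC modzMDl -addn1 PoszD.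
Qed.

Theorem theorem4p20 (R : realType) (m n : nat) (la mu : seq nat)
    (r : int) :
  (0 < m)%N -> (0 < n)%N ->
  is_partition la -> is_partition mu -> part_sub mu la ->
  let l := size (conj_part la) in
  (forall i : nat, (1 <= i <= l)%N ->
     (0 < (part (conj_part la) i)%:Z - (part (conj_part mu) i)%:Z)%R) ->
  corner_color_condition m n r la mu ->
  loop_schur (indet R m n) r la mu
  = minor (Mtilde (indet R m n)) (row_set l mu r) (col_set m l la r).
Proof.
case: n => // n' m_gt0 _ part_la part_mu sub_mu_la l col_gt0 corners.
apply: loop_schur_minor => // k /andP[k_gt0 le_k]; rewrite /shape_inv le_k.
set rect := nseq _ _.
have lt_row (s : seq_sub (skew_cells rect [::])) : ((val s).1.-1 < m)%N.
  have := valP s; case: (val s) => a c /=; rewrite mem_skew_cells ?sorted_nseq //.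
  by rewrite col_len_nseq; case: ifP; lia.
(* The tableau with entry a throughout row a; the rectangle has m - k + 1 <= m rows. *)
apply: (@loop_schur_indet_neq0 _ _ _ _ _ _ [ffun s => Ordinal (lt_row s)]).
apply/forallP => s; apply/forallP => t; rewrite !ffunE /=.
have := valP t; have := valP s; rewrite /=; case: (ssval s) (ssval t) => [a c] [a' c'] /=.
rewrite !mem_skew_cells ?sorted_nseq //.
by move=> s_in t_in; apply/andP; split; apply/implyP; lia.
Qed.
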